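(* Let $\mathcal{O}_q(G/L_S)$ be an irreducible quantum flag manifold and consider the quantum principal $\mathcal{O}(U_1)$-bundle with total space $P=\mathcal{O}_q(G/L_S^{\mathrm{s}})$, base $\mathcal{O}_q(G/L_S)$ and calculus $\Omega^{(0,1)}_q(G/L_S^{\mathrm{s}})$. Then the zero map $\Omega^{(0,1)}_q(G/L_S^{\mathrm{s}})\to\Omega^{(0,1)}_q(G/L_S^{\mathrm{s}})$ is a left $\mathcal{O}_q(G)$-covariant strong principal connection.
   Context: Quantum groups. Let $\mathfrak{g}$ be a finite-dimensional complex simple Lie algebra of rank $l$ with Cartan subalgebra $\mathfrak{h}$, simple roots $\Pi=\{\alpha_1,\dots,\alpha_l\}$, positive roots $R^+$, Weyl group with longest element $w_0$, and form $(\cdot,\cdot)$ on $\mathfrak{h}^*$ normalised so that shortest simple roots satisfy $(\alpha_i,\alpha_i)=2$. Put $\alpha_i^\vee=2\alpha_i/(\alpha_i,\alpha_i)$, $a_{ij}=(\alpha_i^\vee,\alpha_j)$; let $\varpi_1,\dots,\varpi_l$ be the fundamental weights and $\mathcal{P}^+$ the dominant integral weights. Fix $q\in\mathbb{R}\setminus\{-1,0,1\}$ and $q_i=q^{(\alpha_i,\alpha_i)/2}$. $U_q(\mathfrak{g})$ is the Hopf algebra generated by $E_i,F_i,K_i^{\pm1}$ with $K_iK_j=K_jK_i$, $K_iE_j=q_i^{a_{ij}}E_jK_i$, $K_iF_j=q_i^{-a_{ij}}F_jK_i$, $E_iF_j-F_jE_i=\delta_{ij}(K_i-K_i^{-1})/(q_i-q_i^{-1})$,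 the quantum Serre relations, $\Delta(K_i)=K_i\otimes K_i$, $\Delta(E_i)=E_i\otimes K_i+1\otimes E_i$, $\Delta(F_i)=F_i\otimes1+K_i^{-1}\otimes F_i$, $\varepsilon(E_i)=\varepsilon(F_i)=0$, $\varepsilon(K_i)=1$. For $\lambda\in\mathcal{P}^+$, $V_\lambda$ is the finite-dimensional irreducible (type-1) left module generated by a vector $v$ with $E_iv=0$ and $K_iv=q^{(\alpha_i,\lambda)}v$ for all $i$. For $v\in V_\lambda$, $f\in V_\lambda^*$ set $c^{\lambda}_{f,v}(X)=f(Xv)$, $X\in U_q(\mathfrak{g})$. $\mathcal{O}_q(G)\subseteq U_q(\mathfrak{g})^\circ$ is the Hopf subalgebra spanned by all $c^{\lambda}_{f,v}$, $\lambda\in\mathcal{P}^+$. It carries the left action $X\triangleright a=a_{(1)}a_{(2)}(X)$ and the right action $a\triangleleft X=a_{(1)}(X)a_{(2)}$ of $U_q(\mathfrak{g})$. Irreducible quantum flag manifolds. For $S\subseteq\Pi$, $U_q(\mathfrak{l}_S)$ is the subalgebra generated by all $K_i^{\pm1}$ and by $E_j,F_j$ for $\alpha_j\in S$; $U_q(\mathfrak{l}_S^{\mathrm{s}})$ is the subalgebra generated by $K_j^{\pm1},E_j,F_j$ for $\alpha_j\in S$. Set $\mathcal{O}_q(G/L_S)=\{b\in\mathcal{O}_q(G): X\triangleright b=\varepsilon(X)b\ \forall X\in U_q(\mathfrak{l}_S)\}$ and $\mathcal{O}_q(G/L_S^{\mathrm{s}})=\{b: X\triangleright b=\varepsilon(X)b\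 \forall X\in U_q(\mathfrak{l}_S^{\mathrm{s}})\}$. The quantum flag manifold is irreducible when $S=\Pi\setminus\{\alpha_x\}$ with $\alpha_x$ of coefficient $1$ in the highest root (up to diagram automorphism: any node of $A_n$; the first node of $B_n$; the last node of $C_n$; the first node or a spin node of $D_n$; an end node of a long leg of $E_6$; the end node $7$ of $E_7$). Generators and $\mathcal{O}(U_1)$-coaction. Let $N=\dim V_{\varpi_x}$, let $v_1,\dots,v_N$ be a weight basis of $V_{\varpi_x}$ with $v_N$ a highest weight vector, and $f_1,\dots,f_N$ the dual basis of $V_{\varpi_x}^*\cong V_{-w_0(\varpi_x)}$ (left action $(Xf)(v)=f(S(X)v)$). Then $z_i=c^{\varpi_x}_{f_i,v_N}$ and $\overline{z}_j=c^{-w_0(\varpi_x)}_{v_j,f_N}$ generate $P=\mathcal{O}_q(G/L_S^{\mathrm{s}})$, which has a $\mathbb{Z}$-algebra grading with $\deg z_i=1$, $\deg\overline{z}_j=-1$ and degree zero part $\mathcal{O}_q(G/L_S)$. Equivalently $P$ is a right comodule algebra over the Hopf algebra $\mathcal{O}(U_1)=\mathbb{C}[t,t^{-1}]$ ($t$ grouplike) via $p\mapsto p\otimes t^{k}$ for $p$ of degree $k$; its coinvariants are $\mathcal{O}_q(G/L_S)$. Let $S_q[G/L_S]\subseteq P$ be the subalgebra generated by the $z_i$. Calculi. A first-order differential calculus (fodc) over an algebra $B$ is a $B$-bimodule $\Omega^1$ with a derivation $\mathrm{d}:B\to\Omega^1$ such that $\Omega^1$ is generated as a left module by $\mathrm{d}B$.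 Its restriction to a subalgebra $B'$ is the fodc over $B'$ generated inside $\Omega^1$ by the $\mathrm{d}b$, $b\in B'$. A fodc over a right $H$-comodule algebra $P$ is right $H$-covariant if $p\,\mathrm{d}p'\mapsto p_{(0)}\mathrm{d}p'_{(0)}\otimes p_{(1)}p'_{(1)}$ is well defined; left covariance is analogous. The $(0,1)$-calculus over $B=\mathcal{O}_q(G/L_S)$. Let $B^+=\ker(\varepsilon|_B)$, $K=U_q(\mathfrak{l}_S)$. Let $T^{(0,1)}$ be the span of the functionals on $B$ given by the Lusztig quantum root vectors $E_\beta$, $\beta\in R^+\setminus\mathbb{Z}S$, the underlying reduced decomposition of $w_0$ being such that $T^{(0,1)}$ is stable under left multiplication by $K$; explicitly, $T^{(0,1)}$ is the space of functionals induced by $U_q(\mathfrak{l}_S)E_x$. Put $I=\{b\in B^+: X(b)=0\ \forall X\in T^{(0,1)}\}$ and $V=B^+/I$, a right $B$-module and a right $K$-module via $\triangleleft$. Then $\Omega^{(0,1)}_q(G/L_S)$ consists of the $\sum_i a_i\otimes v_i\in\mathcal{O}_q(G)\otimes V$ with $\sum_i(Y\triangleright a_i)\otimes v_i=\sum_i a_i\otimes(v_i\triangleleft Y)$ for all $Y\in K$, with left $B$-action on the first factor, right action $(a\otimes v)b=ab_{(1)}\otimes vb_{(2)}$, left $\mathcal{O}_q(G)$-coaction on the first factor, and $\overline{\partial}b=b_{(1)}\otimes[b_{(2)}-\varepsilon(b_{(2)})1]$. The $(0,1)$-calculus over $P$. $(\Omega^{(0,1)}_q(G/L_S^{\mathrm{s}}),\overline{\partial})$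 is the fodc over $P$ constructed by Heckenberger and Kolb; it is the unique left $\mathcal{O}_q(G)$-covariant fodc over $P$ such that $\overline{\partial}f=0$ for all $f\in S_q[G/L_S]$ and whose restriction to $\mathcal{O}_q(G/L_S)$ is $\Omega^{(0,1)}_q(G/L_S)$. It is right $\mathcal{O}(U_1)$-covariant and makes $P$ a quantum principal $\mathcal{O}(U_1)$-bundle over $B$. Principal connections. For a quantum principal $H$-bundle $(P,\Omega^1(P))$ with base $B=P^{\mathrm{co}(H)}$ and $\Omega^1(B)$ the restriction of $\Omega^1(P)$ to $B$, a principal connection is a left $P$-module, right $H$-comodule projection $\Pi:\Omega^1(P)\to\Omega^1(P)$ with $\ker(\Pi)=P\Omega^1(B)P$. It is strong if $(\mathrm{id}-\Pi)(\mathrm{d}P)\subseteq\Omega^1(B)P$. Left $\mathcal{O}_q(G)$-covariant means that $\Pi$ is a left $\mathcal{O}_q(G)$-comodule map. *)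

(* Defs.v *)
From HB Require Import structures.
From mathcomp Require Import all_boot all_order all_algebra.
From mathcomp Require Import generic_quotient.
From mathcomp Require Import boolp reals.
From mathcomp Require Import complex.

Set Implicit Arguments.
Unset Strict Implicit.
Unset Printing Implicit Defensive.

Import Order.TTheory GRing.Theory Num.Theory.
Local Open Scope ring_scope.
Local Open Scope quotient_scope.

(** [tens V W] is the quotient of finite formal sums of pairs [(v, w)] by the
    coarsest identification compatible with all bilinear maps, so that
    [tlift beta] below is the linear map [V (x) W -> Z] induced by a bilinear
    [beta] (see [tlift_pure] and [tlift_linear]).  [tlift beta] is meaningful
    only for bilinear [beta]. *)

Section Tensor.
Context {K : fieldType} {V W : lmodType K}.

Definition bilin (Z : lmodType K) (beta : V -> W -> Z) : Prop :=
  (forall w, linear (beta^~ w)) /\ (forall v, linear (beta v)).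

Definition tsum (Z : lmodType K) (beta : V -> W -> Z) (s : seq (V * W)) : Z :=
  \sum_(p <- s) beta p.1 p.2.

Definition teqv (s t : seq (V * W)) : bool :=
  `[< forall (Z : lmodType K) (beta : V -> W -> Z),
        bilin beta -> tsum beta s = tsum beta t >].

Lemma teqv_refl : reflexive teqv.
Proof. by move=> s; apply/asboolP. Qed.

Lemma teqv_sym : symmetric teqv.
Proof.
by move=> s t; apply/asboolP/asboolP => h Z beta hb; rewrite h.
Qed.

Lemma teqv_trans : transitive teqv.
Proof.
by move=> t s u /asboolP h1 /asboolP h2; apply/asboolP => Z beta hb; rewrite h1 // h2.
Qed.

Canonical teqv_equiv := EquivRel teqv teqv_refl teqv_sym teqv_trans.

Definition tens : Type := {eq_quot teqv_equiv}.

HB.instance Definition _ := Choice.on tens.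
HB.instance Definition _ := EqQuotient.on tens.

Definition tlift (Z : lmodType K) (beta : V -> W -> Z) (x : tens) : Z :=
  tsum beta (repr x).

Definition tpure (v : V) (w : W) : tens := \pi_tens [:: (v, w)].

Lemma tlift_pi (Z : lmodType K) (beta : V -> W -> Z) s :
  bilin beta -> tlift beta (\pi_tens s) = tsum beta s.
Proof.
move=> hb; rewrite /tlift; case: piP => t /eqmodP /asboolP h.
by rewrite -(h _ _ hb).
Qed.

Lemma tensP (x y : tens) :
  (forall (Z : lmodType K) (beta : V -> W -> Z),
     bilin beta -> tlift beta x = tlift beta y) -> x = y.
Proof.
move=> h; rewrite -[x]reprK -[y]reprK; apply/eqmodP/asboolP => Z beta hb.
exact: h.
Qed.

Definition tzero : tens := \pi_tens [::].
Definition tadd (x y : tens) : tens := \pi_tens (repr x ++ repr y).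
Definition tscale (c : K) (x : tens) : tens :=
  \pi_tens [seq (c *: p.1, p.2) | p <- repr x].
Definition topp (x : tens) : tens := tscale (-1) x.

Lemma tlift0 (Z : lmodType K) (beta : V -> W -> Z) :
  bilin beta -> tlift beta tzero = 0.
Proof. by move=> hb; rewrite tlift_pi // /tsum big_nil. Qed.

Lemma tliftD (Z : lmodType K) (beta : V -> W -> Z) x y :
  bilin beta -> tlift beta (tadd x y) = tlift beta x + tlift beta y.
Proof. by move=> hb; rewrite tlift_pi // /tsum big_cat. Qed.

Lemma tliftZ (Z : lmodType K) (beta : V -> W -> Z) c x :
  bilin beta -> tlift beta (tscale c x) = c *: tlift beta x.
Proof.
move=> hb; rewrite tlift_pi // /tsum big_map scaler_sumr.
apply: eq_bigr => p _ /=; have [h _] := hb.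
have e0 : beta 0 p.2 = 0.
  have := h p.2 (-1) 0 0; rewrite /= scaler0 addr0 scaleN1r => e.
  by rewrite e addNr.
by have := h p.2 c p.1 0; rewrite /= e0 !addr0.
Qed.

Lemma tliftN (Z : lmodType K) (beta : V -> W -> Z) x :
  bilin beta -> tlift beta (topp x) = - tlift beta x.
Proof. by move=> hb; rewrite tliftZ // scaleN1r. Qed.

Lemma taddA : associative tadd.
Proof. by move=> x y z; apply: tensP => Z beta hb; rewrite !tliftD // addrA. Qed.
Lemma taddC : commutative tadd.
Proof. by move=> x y; apply: tensP => Z beta hb; rewrite !tliftD // addrC. Qed.
Lemma tadd0 : left_id tzero tadd.
Proof. by move=> x; apply: tensP => Z beta hb; rewrite tliftD // tlift0 // add0r. Qed.
Lemma taddN : left_inverse tzero topp tadd.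
Proof.
by move=> x; apply: tensP => Z beta hb; rewrite tliftD // tliftN // tlift0 // addNr.
Qed.

HB.instance Definition _ := GRing.isZmodule.Build tens taddA taddC tadd0 taddN.

Lemma tscaleA a b x : tscale a (tscale b x) = tscale (a * b) x.
Proof. by apply: tensP => Z beta hb; rewrite !tliftZ // scalerA. Qed.
Lemma tscale1 : left_id 1 tscale.
Proof. by move=> x; apply: tensP => Z beta hb; rewrite !tliftZ // scale1r. Qed.
Lemma tscaleDr : right_distributive tscale +%R.
Proof.
by move=> c x y; apply: tensP => Z beta hb; rewrite !(tliftZ, tliftD) // scalerDr.
Qed.
Lemma tscaleDl x : {morph tscale^~ x : a b / a + b}.
Proof.
by move=> a b; apply: tensP => Z beta hb; rewrite !(tliftZ, tliftD) // scalerDl.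
Qed.

HB.instance Definition _ :=
  GRing.Zmodule_isLmodule.Build K tens tscaleA tscale1 tscaleDr tscaleDl.

Lemma tlift_pure (Z : lmodType K) (beta : V -> W -> Z) v w :
  bilin beta -> tlift beta (tpure v w) = beta v w.
Proof. by move=> hb; rewrite tlift_pi // /tsum big_seq1. Qed.

Lemma tlift_linear (Z : lmodType K) (beta : V -> W -> Z) :
  bilin beta -> linear (tlift beta).
Proof. by move=> hb c x y; rewrite tliftD // tliftZ. Qed.

Lemma tens_pureE (x : tens) : x = \sum_(p <- repr x) tpure p.1 p.2.
Proof.
apply: tensP => Z beta hb; rewrite {1}/tlift /tsum.
elim: (repr x) => [|p s IH]; first by rewrite !big_nil [RHS]tlift0.
by rewrite !big_cons [RHS]tliftD // IH tlift_pure.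
Qed.

Definition tspan (P : V -> Prop) (Q : W -> Prop) (x : tens) : Prop :=
  exists2 s : seq (V * W),
    (forall p, p \in s -> P p.1 /\ Q p.2)
    & x = \sum_(p <- s) tpure p.1 p.2.

End Tensor.

Arguments tens {K} V W.

Notation "v ⊗ w" := (tpure v w) (at level 40, left associativity) : ring_scope.

Definition tmap (K : fieldType) (V V' W W' : lmodType K)
    (f : V -> V') (g : W -> W') : tens V W -> tens V' W' :=
  tlift (fun v w => f v ⊗ g w).

Definition tmul (K : fieldType) (A B : algType K) (x y : tens A B) : tens A B :=
  tlift (fun a b => tlift (fun a' b' => (a * a') ⊗ (b * b')) y) x.

Inductive gen_subalg (K : fieldType) (A : algType K) (G : A -> Prop) : A -> Prop :=
| gen_subalg_gen a : G a -> gen_subalg G a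
| gen_subalg_1 : gen_subalg G 1
| gen_subalg_lin c a b :
    gen_subalg G a -> gen_subalg G b -> gen_subalg G (c *: a + b)
| gen_subalg_mul a b : gen_subalg G a -> gen_subalg G b -> gen_subalg G (a * b).

Record hopfAlgebra (K : fieldType) := HopfAlgebra {
  hopf_alg :> algType K;
  comul : {linear hopf_alg -> tens hopf_alg hopf_alg};
  counit : {linear hopf_alg -> K^o};
  antipode : {linear hopf_alg -> hopf_alg};
  comul1 : comul 1 = 1 ⊗ 1;
  comulM : forall a b, comul (a * b) = tmul (comul a) (comul b);
  counit1 : counit 1 = 1;
  counitM : forall a b, counit (a * b) = counit a * counit b;
  comulA : forall a,
    tlift (fun a1 a2 => tlift (fun a11 a12 => a11 ⊗ (a12 ⊗ a2)) (comul a1)) (comul a)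
    = tlift (fun a1 a2 => a1 ⊗ comul a2) (comul a);
  comul_counitl : forall a, tlift (fun a1 a2 => counit a1 *: a2) (comul a) = a;
  comul_counitr : forall a, tlift (fun a1 a2 => counit a2 *: a1) (comul a) = a;
  antipodel : forall a, tlift (fun a1 a2 => antipode a1 * a2) (comul a) = counit a *: 1;
  antipoder : forall a, tlift (fun a1 a2 => a1 * antipode a2) (comul a) = counit a *: 1
}.

(** [H] is the Laurent polynomial algebra with basis [t k], the [k]-th power
    of a grouplike generator, [k] an integer. *)
Record is_laurent (K : fieldType) (H : hopfAlgebra K) (t : int -> H) : Prop := {
  laurent0 : t 0 = 1;
  laurentD : forall m n, t (m + n) = t m * t n;
  laurent_comul : forall m, comul H (t m) = t m ⊗ t m;
  laurent_span : forall h : H, exists (s : seq int) (c : int -> K),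
    h = \sum_(k <- s) c k *: t k;
  laurent_free : forall (s : seq int) (c : int -> K), uniq s ->
    \sum_(k <- s) c k *: t k = 0 -> forall k, k \in s -> c k = 0
}.

(** [A i j] is the Cartan integer $a_{ij}$ and [d i] is
    $(\alpha_i,\alpha_i)/2$, so that [d i * A i j] is $(\alpha_i,\alpha_j)$.
    Finite-dimensional complex simple Lie algebras correspond to the
    indecomposable Cartan matrices of finite type. *)

Record simple_cartan (R : realType) (l : nat) (A : 'M[int]_l) (d : 'I_l -> nat)
    : Prop := {
  cartan_diag : forall i, A i i = 2;
  cartan_offdiag : forall i j, i != j -> A i j <= 0;
  cartan_sym : forall i j, (d i)%:Z * A i j = (d j)%:Z * A j i;
  cartan_pos : forall v : 'rV[R]_l, v != 0 ->
    0 < \sum_i \sum_j v 0 i * v 0 j * ((d i)%:Z * A i j)%:~R;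
  cartan_indec : forall J : {set 'I_l}, J != set0 -> J != setT ->
    exists i j, [/\ i \in J, j \notin J & A i j != 0];
  cartan_d_pos : forall i, (0 < d i)%N;
  cartan_d_short : exists i, d i = 1%N
}.

(** Roots, as coordinate vectors with respect to the simple roots. *)
Inductive is_root (l : nat) (A : 'M[int]_l) : 'rV[int]_l -> Prop :=
| root_simple i : is_root A (delta_mx 0 i)
| root_refl i b : is_root A b ->
    is_root A (b - (\sum_j A i j * b 0 j) *: delta_mx 0 i).

Definition is_highest_root (l : nat) (A : 'M[int]_l) (th : 'rV[int]_l) : Prop :=
  is_root A th /\ forall b, is_root A b -> forall i, b 0 i <= th 0 i.

(** $\alpha_x$ has coefficient 1 in the highest root. *)
Definition irreducible_node (l : nat) (A : 'M[int]_l) (x : 'I_l) : Prop :=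
  exists2 th, is_highest_root A th & th 0 x = 1.

Definition qnum (K : fieldType) (p : K) (n : nat) : K :=
  (p ^+ n - p ^- n) / (p - p^-1).
Definition qfact (K : fieldType) (p : K) (n : nat) : K :=
  \prod_(1 <= k < n.+1) qnum p k.
Definition qbinom (K : fieldType) (p : K) (n k : nat) : K :=
  qfact p n / (qfact p k * qfact p (n - k)).

Section Uq.
Context {R : realType} {l : nat} (A : 'M[int]_l) (d : 'I_l -> nat) (q : R).
Local Notation C := (complex R).

Definition qi (i : 'I_l) : C := (q%:C)%C ^+ d i.

Record Uq_relations (B : algType C) (E F K Kinv : 'I_l -> B) : Prop := {
  Urel_Kinvr : forall i, K i * Kinv i = 1;
  Urel_Kinvl : forall i, Kinv i * K i = 1;
  Urel_KK : forall i j, K i * K j = K j * K i;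
  Urel_KE : forall i j, K i * E j = qi i ^ A i j *: (E j * K i);
  Urel_KF : forall i j, K i * F j = qi i ^ (- A i j) *: (F j * K i);
  Urel_EF : forall i j, E i * F j - F j * E i =
    if i == j then (qi i - (qi i)^-1)^-1 *: (K i - Kinv i) else 0;
  Urel_serreE : forall i j, i != j ->
    let n := `|1 - A i j|%N in
    \sum_(k < n.+1)
      ((-1) ^+ k * qbinom (qi i) n k) *: (E i ^+ (n - k) * E j * E i ^+ k) = 0;
  Urel_serreF : forall i j, i != j ->
    let n := `|1 - A i j|%N in
    \sum_(k < n.+1)
      ((-1) ^+ k * qbinom (qi i) n k) *: (F i ^+ (n - k) * F j * F i ^+ k) = 0
}.

(** The Hopf algebra presented by the generators [E F K Kinv] and the
    relations above; [Uq_gen] and [Uq_universal] say that it is generated by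
    them and that no further relations hold. *)
Record Uq := MkUq {
  Uq_hopf :> hopfAlgebra C;
  UE : 'I_l -> Uq_hopf;
  UF : 'I_l -> Uq_hopf;
  UK : 'I_l -> Uq_hopf;
  UKinv : 'I_l -> Uq_hopf;
  Uq_rel : Uq_relations UE UF UK UKinv;
  Uq_gen : forall X : Uq_hopf,
    gen_subalg (fun Y => exists i, [\/ Y = UE i, Y = UF i, Y = UK i | Y = UKinv i]) X;
  Uq_universal : forall (B : algType C) (E F K Kinv : 'I_l -> B),
    Uq_relations E F K Kinv ->
    exists phi : {lrmorphism Uq_hopf -> B}, forall i,
      [/\ phi (UE i) = E i, phi (UF i) = F i,
          phi (UK i) = K i & phi (UKinv i) = Kinv i];
  Uq_comulK : forall i, comul Uq_hopf (UK i) = UK i ⊗ UK i;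
  Uq_comulE : forall i, comul Uq_hopf (UE i) = UE i ⊗ UK i + 1 ⊗ UE i;
  Uq_comulF : forall i, comul Uq_hopf (UF i) = UF i ⊗ 1 + UKinv i ⊗ UF i;
  Uq_counitK : forall i, counit Uq_hopf (UK i) = 1;
  Uq_counitE : forall i, counit Uq_hopf (UE i) = 0;
  Uq_counitF : forall i, counit Uq_hopf (UF i) = 0
}.

End Uq.

Section Quantum.
Context {R : realType} {l : nat} {A : 'M[int]_l} {d : 'I_l -> nat} {q : R}.
Local Notation C := (complex R).

Definition Ulevi (U : Uq A d q) (S : {set 'I_l}) : U -> Prop :=
  gen_subalg (fun Y => (exists i, Y = UK U i \/ Y = UKinv U i)
                    \/ (exists2 j, j \in S & Y = UE U j \/ Y = UF U j)).

Definition Ulevi_s (U : Uq A d q) (S : {set 'I_l}) : U -> Prop :=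
  gen_subalg (fun Y => exists2 j, j \in S
                & [\/ Y = UK U j, Y = UKinv U j, Y = UE U j | Y = UF U j]).

Arguments Ulevi U S _ : clear implicits.
Arguments Ulevi_s U S _ : clear implicits.

Record Umod (U : Uq A d q) := MkUmod {
  mod_vect :> vectType C;
  mact : {linear U -> 'End(mod_vect)};
  mact1 : mact 1 = \1%VF;
  mactM : forall X Y, mact (X * Y) = (mact X \o mact Y)%VF
}.

(** A dominant integral weight $\lambda=\sum_i m_i\varpi_i$ is given by
    [m : 'I_l -> nat]; then $(\alpha_i,\lambda)$ is [d i * m i]. *)
Record is_irr_hw (U : Uq A d q) (M : Umod U) (m : 'I_l -> nat) (v : M) : Prop := {
  irr_hw_neq0 : v != 0;
  irr_hw_E : forall i, mact M (UE U i) v = 0;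
  irr_hw_K : forall i, mact M (UK U i) v = (q%:C)%C ^+ (d i * m i) *: v;
  irr_hw_gen : forall w, exists X, w = mact M X v;
  irr_hw_irr : forall W : {vspace M},
    (forall X, (mact M X @: W <= W)%VS) -> W = 0%VS \/ W = fullv
}.

Definition fund_weight (x : 'I_l) : 'I_l -> nat := fun i => (i == x)%N.

Definition is_weight_vector (U : Uq A d q) (M : Umod U) (v : M) : Prop :=
  exists mu : 'I_l -> int, forall i, mact M (UK U i) v = qi d q i ^ mu i *: v.

Definition mcoef (U : Uq A d q) (M : Umod U) (f : M -> C) (v : M) : U -> C :=
  fun X => f (mact M X v).
Definition dual_act (U : Uq A d q) (M : Umod U) (X : U) (f : M -> C) : M -> C :=
  fun v => f (mact M (antipode U X) v).

(** A Hopf subalgebra of the Hopf dual of [U] is given as a Hopf algebra with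
    an injective evaluation [ev a X] (the value of the functional [a] at [X])
    dual to the structure of [U]. *)

Definition is_irr_coef (U : Uq A d q) (c : U -> C) : Prop :=
  exists (M : Umod U) (m : 'I_l -> nat) (v0 : M), is_irr_hw m v0 /\
  exists (f : {linear M -> C^o}) (v : M), forall X, c X = mcoef f v X.

Record Oq (U : Uq A d q) := MkOq {
  Oq_hopf :> hopfAlgebra C;
  ev : Oq_hopf -> U -> C;
  ev_bilin : bilin (ev : Oq_hopf -> U -> C^o);
  ev_inj : forall a b : Oq_hopf, (forall X, ev a X = ev b X) -> a = b;
  ev_mul : forall a b X,
    ev (a * b) X = tlift (fun X1 X2 => ev a X1 * ev b X2 : C^o) (comul U X);
  ev_one : forall X, ev 1 X = counit U X;
  ev_comul : forall a X Y,
    ev a (X * Y) = tlift (fun a1 a2 => ev a1 X * ev a2 Y : C^o) (comul Oq_hopf a);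
  ev_counit : forall a, counit Oq_hopf a = ev a 1;
  ev_antipode : forall a X, ev (antipode Oq_hopf a) X = ev a (antipode U X);
  Oq_coef : forall c : U -> C, is_irr_coef c -> exists a, forall X, ev a X = c X;
  Oq_span : forall a, exists (n : nat) (c : 'I_n -> U -> C),
    (forall k, is_irr_coef (c k)) /\ forall X, ev a X = \sum_k c k X
}.

Definition lharp (U : Uq A d q) (O : Oq U) (X : U) (a : O) : O :=
  tlift (fun a1 a2 => ev a2 X *: a1) (comul O a).
Definition rharp (U : Uq A d q) (O : Oq U) (a : O) (X : U) : O :=
  tlift (fun a1 a2 => ev a1 X *: a2) (comul O a).

Definition Oinv (U : Uq A d q) (O : Oq U) (L : U -> Prop) (b : O) : Prop :=
  forall X, L X -> lharp X b = counit U X *: b.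

Definition flag (U : Uq A d q) (O : Oq U) (S : {set 'I_l}) : O -> Prop :=
  Oinv (Ulevi U S).
Definition flag_s (U : Uq A d q) (O : Oq U) (S : {set 'I_l}) : O -> Prop :=
  Oinv (Ulevi_s U S).

End Quantum.

Arguments Ulevi {R l A d q} U S _.
Arguments Ulevi_s {R l A d q} U S _.

(** A calculus over a subalgebra [P] of an algebra [O], [P] being given as a
    predicate.  The actions and the differential are total functions on [O],
    but only their restrictions to [P] carry meaning. *)

Record fodc (K : fieldType) (O : algType K) (P : O -> Prop) := Fodc {
  fodc_vect :> lmodType K;
  lact : O -> fodc_vect -> fodc_vect;
  ract : fodc_vect -> O -> fodc_vect;
  dd : O -> fodc_vect;
  lact_linl : forall c a b g, P a -> P b ->
    lact (c *: a + b) g = c *: lact a g + lact b g;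
  lact_linr : forall a, P a -> linear (lact a);
  lact1 : forall g, lact 1 g = g;
  lactM : forall a b g, P a -> P b -> lact (a * b) g = lact a (lact b g);
  ract_linl : forall c a b g, P a -> P b ->
    ract g (c *: a + b) = c *: ract g a + ract g b;
  ract_linr : forall a, P a -> linear (ract^~ a);
  ract1 : forall g, ract g 1 = g;
  ractM : forall a b g, P a -> P b -> ract g (a * b) = ract (ract g a) b;
  lractA : forall a b g, P a -> P b -> ract (lact a g) b = lact a (ract g b);
  dd_lin : forall c a b, P a -> P b -> dd (c *: a + b) = c *: dd a + dd b;
  dd_leibniz : forall a b, P a -> P b -> dd (a * b) = ract (dd a) b + lact a (dd b);
  dd_gen : forall g, exists2 s : seq (O * O),
    (forall p, p \in s -> P p.1 /\ P p.2) & g = \sum_(p <- s) lact p.1 (dd p.2)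
}.

Arguments lact {K O P} G _ _ : rename.
Arguments ract {K O P} G _ _ : rename.
Arguments dd {K O P} G _ : rename.

Section Calculus.
Context {K : fieldType}.

(** For a subalgebra [B] of [P], [restr B], [restr_P B] and [P_restr_P B] are
    $\Omega^1(B)=B\,\mathrm dB$, $\Omega^1(B)P$ and $P\Omega^1(B)P$. *)
Definition restr (O : algType K) (P : O -> Prop) (G : fodc P) (B : O -> Prop)
    (g : G) : Prop :=
  exists2 s : seq (O * O),
    (forall p, p \in s -> B p.1 /\ B p.2)
    & g = \sum_(p <- s) lact G p.1 (dd G p.2).

Definition restr_P (O : algType K) (P : O -> Prop) (G : fodc P) (B : O -> Prop)
    (g : G) : Prop :=
  exists2 s : seq (G * O),
    (forall p, p \in s -> restr B p.1 /\ P p.2)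
    & g = \sum_(p <- s) ract G p.1 p.2.

Definition P_restr_P (O : algType K) (P : O -> Prop) (G : fodc P) (B : O -> Prop)
    (g : G) : Prop :=
  exists2 s : seq (O * G * O),
    (forall p, p \in s -> [/\ P p.1.1, restr B p.1.2 & P p.2])
    & g = \sum_(p <- s) ract G (lact G p.1.1 p.1.2) p.2.

(** Covariance of a calculus over the left [O]-comodule algebra [P]
    (coaction [comul]) and over the right [H]-comodule algebra [P]
    (coaction [rho]): [delta] is the well-defined map
    $p\,\mathrm dp'\mapsto p_{(1)}p'_{(1)}\otimes p_{(2)}\mathrm dp'_{(2)}$,
    resp. $p\,\mathrm dp'\mapsto p_{(0)}\mathrm dp'_{(0)}\otimes
    p_{(1)}p'_{(1)}$.  The lists [s] and [s'] are arbitrary expressions of the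
    coactions of [p] and [p'] as sums of pure tensors with legs in [P]. *)
Definition left_covariant (O : hopfAlgebra K) (P : O -> Prop) (G : fodc P)
    (delta : {linear G -> tens O G}) : Prop :=
  forall (p p' : O) (s s' : seq (O * O)), P p -> P p' ->
    (forall u, u \in s -> P u.2) -> (forall u, u \in s' -> P u.2) ->
    comul O p = \sum_(u <- s) u.1 ⊗ u.2 ->
    comul O p' = \sum_(u <- s') u.1 ⊗ u.2 ->
    delta (lact G p (dd G p')) =
      \sum_(u <- s) \sum_(u' <- s') (u.1 * u'.1) ⊗ lact G u.2 (dd G u'.2).

Definition right_covariant (O : algType K) (P : O -> Prop) (H : hopfAlgebra K)
    (rho : O -> tens O H) (G : fodc P) (delta : {linear G -> tens G H}) : Prop :=
  forall (p p' : O) (s s' : seq (O * H)), P p -> P p' ->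
    (forall u, u \in s -> P u.1) -> (forall u, u \in s' -> P u.1) ->
    rho p = \sum_(u <- s) u.1 ⊗ u.2 ->
    rho p' = \sum_(u <- s') u.1 ⊗ u.2 ->
    delta (lact G p (dd G p')) =
      \sum_(u <- s) \sum_(u' <- s') lact G u.1 (dd G u'.1) ⊗ (u.2 * u'.2).

Record is_principal_connection (O : algType K) (P : O -> Prop) (B : O -> Prop)
    (H : hopfAlgebra K) (G : fodc P) (deltaR : {linear G -> tens G H})
    (Pi : G -> G) : Prop := {
  conn_linear : linear Pi;
  conn_left : forall p g, P p -> Pi (lact G p g) = lact G p (Pi g);
  conn_comod : forall g, deltaR (Pi g) = tmap Pi id (deltaR g);
  conn_proj : forall g, Pi (Pi g) = Pi g;
  conn_ker : forall g, Pi g = 0 <-> P_restr_P B g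
}.

Definition is_strong (O : algType K) (P : O -> Prop) (B : O -> Prop)
    (G : fodc P) (Pi : G -> G) : Prop :=
  forall p, P p -> restr_P B (dd G p - Pi (dd G p)).

Definition is_left_comod_map (O : hopfAlgebra K) (P : O -> Prop) (G : fodc P)
    (deltaL : {linear G -> tens O G}) (Pi : G -> G) : Prop :=
  forall g, deltaL (Pi g) = tmap id Pi (deltaL g).

End Calculus.

Section Calculus01.
Context {R : realType} {l : nat} {A : 'M[int]_l} {d : 'I_l -> nat} {q : R}.
Context {U : Uq A d q} (O : Oq U) (x : 'I_l).
Local Notation C := (complex R).
Local Notation S := [set~ x].
Local Notation B := (flag (O := O) S).

(** $T^{(0,1)}$ consists of the functionals induced by
    [Y * UE U x], [Y] in $U_q(\mathfrak l_S)$. *)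
Definition Bplus (b : O) : Prop := B b /\ counit O b = 0.
Definition Iideal (b : O) : Prop :=
  Bplus b /\ forall Y, Ulevi U S Y -> ev b (Y * UE U x) = 0.

(** $\mathcal O_q(G)\otimes V$ with $V=B^+/I$ is the quotient of the subspace
    $\mathcal O_q(G)\otimes B^+$ of $\mathcal O_q(G)\otimes\mathcal O_q(G)$ by
    $\mathcal O_q(G)\otimes I$: elements are given by representatives, and
    [eqV] is equality in the quotient. *)
Definition eqV (t u : tens O O) : Prop := tspan (fun _ => True) Iideal (t - u).

Definition Omega01 (t : tens O O) : Prop :=
  tspan (fun _ => True) Bplus t /\
  forall Y, Ulevi U S Y ->
    eqV (tmap (lharp Y) id t) (tmap id (fun b => rharp b Y) t).

Definition dbar (b : O) : tens O O :=
  tmap id (fun c => c - counit O c *: 1) (comul O b).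

(** The restriction to [B] of a calculus [G] over [P] is isomorphic, as a
    calculus, to $\Omega^{(0,1)}_q(G/L_S)$; [phi] sends a form to a
    representative of its image. *)
Definition restricts_to_Omega01 (P : O -> Prop) (G : fodc P) : Prop :=
  exists phi : G -> tens O O,
    (forall g, restr B g -> Omega01 (phi g)) /\
    (forall c g g', restr B g -> restr B g' ->
       eqV (phi (c *: g + g')) (c *: phi g + phi g')) /\
    (forall b g, B b -> restr B g ->
       eqV (phi (lact G b g)) (tmap ( *%R b) id (phi g))) /\
    (forall b g, B b -> restr B g ->
       eqV (phi (ract G g b)) (tmul (phi g) (comul O b))) /\
    (forall b, B b -> eqV (phi (dd G b)) (dbar b)) /\
    (forall g, restr B g -> eqV (phi g) 0 -> g = 0) /\
    (forall t, Omega01 t -> exists2 g, restr B g & eqV (phi g) t).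

Inductive homog (N : nat) (z zb : 'I_N -> O) : int -> O -> Prop :=
| homog1 : homog z zb 0 1
| homog_z k p i : homog z zb k p -> homog z zb (k + 1) (p * z i)
| homog_zb k p i : homog z zb k p -> homog z zb (k - 1) (p * zb i)
| homog_lin k c p p' :
    homog z zb k p -> homog z zb k p' -> homog z zb k (c *: p + p').

End Calculus01.

(* Main.v *)
Require Import Defs.
From HB Require Import structures.
From mathcomp Require Import all_boot all_order all_algebra.
From mathcomp Require Import boolp reals.
From mathcomp Require Import complex.
Import Order.TTheory GRing.Theory Num.Theory.
Local Open Scope ring_scope.

(** The kernel of the zero map is the whole calculus, so that everything follows
    from strongness: for [p] in the total space [P], the form [dd G p] lies in
    [Omega1(B) P]; multiplying by [P] on the left then gives all of the
    calculus ([P_restr_P_total]).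

    The element [K x] acts semisimply on [P] with integral powers of [qi x] as
    eigenvalues, which grades [P] with the base [B] in degree 0
    ([flag_s_graded], [homogeneous0_flag]); the [z i] have degree 1 and the
    [zb i] degree -1 ([homogeneous_z], [homogeneous_zb]).  The generators
    satisfy two sphere relations: the sum of the [zb i * z i] is 1
    ([sum_zb_z]), and so is the sum of the [z i * y i], where [y i] is a
    multiple of [zb i] ([sum_z_zb]).  As [dd G (z i) = 0], the differential
    is linear for right multiplication by [z i], hence
    - if [p] has positive degree, [dd G p] is the sum of the
      [dd G (p * zb i) * z i];
    - if [p] has negative degree, [dd G p] is the sum of the
      [dd G (p * z i) * y i].
    Both formulas bring the degree of the argument closer to 0, where [dd G p]
    is in [Omega1(B)], and induction concludes ([restr_P_dd]).

    The representation theory behind these facts concerns the single highest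
    weight module [V], its highest weight vector [vN] and the coordinate along
    [vN].  Words of lowering operators applied to [vN] span [V]; comparing
    weights shows that [F j] with [j != x] kills [vN], and that the coordinate
    along [vN] vanishes on the images of all [F j] and of [E j] with [j != x].
    This makes [z i] and [zb i] invariant.  The first sphere relation is the
    antipode axiom [S(X1) X2 = counit X]; the second one involves [S(X2)] and
    [X1] in that order, and needs the operator [2 rho] of [V], conjugation by
    which is the square of the antipode ([two_rho_operator],
    [antipode_twist]). *)

Set Implicit Arguments.
Unset Strict Implicit.
Unset Printing Implicit Defensive.

(** * Tensors and coproducts *)

Section SumsOfTensors.
Context {K : fieldType} {V W Z : lmodType K}.

Lemma linear_bigsum (I : Type) (s : seq I) (F : I -> V -> Z) :
  (forall i, linear (F i)) -> linear (fun x => \sum_(i <- s) F i x).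
Proof.
move=> hF c x y; rewrite scaler_sumr -big_split /=.
by apply: eq_bigr => i _; rewrite hF.
Qed.

Lemma linear_addf (f : V -> Z) : linear f -> {morph f : x y / x + y}.
Proof. by move=> h x y; have := h 1 x y; rewrite !scale1r. Qed.

Lemma linear_zerof (f : V -> Z) : linear f -> f 0 = 0.
Proof.
move=> h; have := linear_addf h 0 0; rewrite addr0 => /eqP.
by rewrite -subr_eq0 opprD addrA subrr sub0r oppr_eq0 => /eqP.
Qed.

Lemma linear_scalef (f : V -> Z) : linear f ->
  forall c x, f (c *: x) = c *: f x.
Proof. by move=> h c x; have := h c x 0; rewrite (linear_zerof h) !addr0. Qed.

Lemma linear_sumf (f : V -> Z) : linear f ->
  forall (I : Type) (s : seq I) (Q : pred I) (F : I -> V),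
  f (\sum_(i <- s | Q i) F i) = \sum_(i <- s | Q i) f (F i).
Proof.
by move=> h I s Q F; rewrite (big_morph f (linear_addf h) (linear_zerof h)).
Qed.

End SumsOfTensors.

Lemma tliftE (K : fieldType) (V W Z : lmodType K) (beta : V -> W -> Z) t :
  tlift beta t = \sum_(p <- repr t) beta p.1 p.2.
Proof. by []. Qed.

Lemma tlift_sum (K : fieldType) (V W Z : lmodType K) (beta : V -> W -> Z)
    (I : Type) (s : seq I) (F : I -> tens V W) : bilin beta ->
  tlift beta (\sum_(i <- s) F i) = \sum_(i <- s) tlift beta (F i).
Proof. by move=> hb; rewrite (linear_sumf (tlift_linear hb)). Qed.

Lemma tpure_bilin (K : fieldType) (V W : lmodType K) :
  bilin (fun (v : V) (w : W) => v ⊗ w).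
Proof.
split=> [w c v v'|v c w w']; apply: tensP => Z beta hb;
  rewrite tlift_linear // !tlift_pure //; case: hb => h1 h2;
  [exact: h1 | exact: h2].
Qed.

Section Hopf.
Context {K : fieldType} {H : hopfAlgebra K}.
Implicit Types a b : H.

(** In Sweedler notation [tlift beta (comul H a)] is [beta a1 a2]; with this
    reading coassociativity identifies the two ways of forming [g a1 a2 a3]. *)
Lemma sweedler_assoc (Z : lmodType K) (g : H -> H -> H -> Z) a :
  (forall y w, linear (fun x => g x y w)) ->
  (forall x w, linear (fun y => g x y w)) ->
  (forall x y, linear (fun w => g x y w)) ->
  tlift (fun p w => tlift (fun x y => g x y w) (comul H p)) (comul H a) =
  tlift (fun x r => tlift (fun y w => g x y w) (comul H r)) (comul H a).
Proof.
move=> h1 h2 h3.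
have hg x : bilin (g x) by split=> [w|y]; [exact: h2 | exact: h3].
have hT : bilin (fun x t => tlift (g x) t : Z).
  split=> [|x]; last exact: (tlift_linear (hg x)).
  move=> t; apply: (linear_bigsum _ (F := fun p x => g x p.1 p.2)) => p.
  exact: h1.
have e := congr1 (tlift (fun x t => tlift (g x) t)) (comulA a).
transitivity (tlift (fun x t => tlift (g x) t) (tlift (fun a1 a2 : H =>
   tlift (fun a11 a12 : H => a11 ⊗ (a12 ⊗ a2)) (comul H a1)) (comul H a))).
  rewrite !(tliftE _ (comul H a)) tlift_sum //; apply: eq_bigr => p _.
  rewrite !(tliftE _ (comul H p.1)) tlift_sum //.
  by apply: eq_bigr => r _; rewrite !tlift_pure.
rewrite e !(tliftE _ (comul H a)) tlift_sum //.
by apply: eq_bigr => p _; rewrite tlift_pure.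
Qed.

Lemma tlift_comulM (Z : lmodType K) (beta : H -> H -> Z) a b : bilin beta ->
  tlift beta (comul H (a * b)) =
  tlift (fun a1 a2 => tlift (fun b1 b2 => beta (a1 * b1) (a2 * b2))
                            (comul H b)) (comul H a).
Proof.
move=> hb; rewrite comulM /tmul !(tliftE _ (comul H a)) tlift_sum //.
apply: eq_bigr => p _; rewrite !(tliftE _ (comul H b)) tlift_sum //.
by apply: eq_bigr => r _; rewrite tlift_pure.
Qed.

Lemma mul_bilin (V W : lmodType K) (f : {linear V -> H})
  (g : {linear W -> H}) : bilin (fun x y => f x * g y).
Proof.
split=> [w c x y|v c x y]; rewrite linearP.
  by rewrite mulrDl -scalerAl.
by rewrite mulrDr -scalerAr.
Qed.

Lemma antipode1 : antipode H 1 = 1.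
Proof.
have := antipodel (h := H) 1; rewrite comul1 counit1 scale1r.
by rewrite (tlift_pure _ _ (mul_bilin (antipode H) idfun)) /= mulr1.
Qed.

(** Both sides are convolution inverses of the multiplication: the sum
    S(a1 b1) a2 b2 S(b3) S(a3) collapses to either of them. *)
Lemma antipodeM a b : antipode H (a * b) = antipode H b * antipode H a.
Proof.
pose S := antipode H.
pose F (x y w x' y' w' : H) := S (x * x') * (y * y') * (S w' * S w).
pose Fb x y w := tlift (fun p' w' => tlift (fun x' y' => F x y w x' y' w')
                                          (comul H p')) (comul H b).
pose Fb' x y w := tlift (fun x' r' => tlift (fun y' w' => F x y w x' y' w')
                                          (comul H r')) (comul H b).
have FbE x y w : Fb x y w = Fb' x y w.
  apply: sweedler_assoc => [y' w'|x' w'|x' y'] c u v; rewrite /F.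
  - by rewrite mulrDr linearD -scalerAr linearZ /= !mulrDl -!scalerAl.
  - by rewrite !(mulrDr, mulrDl) -!(scalerAr, scalerAl).
  - by rewrite linearP mulrDl mulrDr -scalerAl -scalerAr.
have hS : bilin (fun x y => S x * y) := mul_bilin (antipode H) idfun.
(* Splitting off the last two legs of [a] and of [b] gives [S (a * b)]. *)
transitivity (tlift (fun x r => tlift (fun y w => Fb' x y w) (comul H r))
                    (comul H a)).
  have eb y w x : Fb' x y w = S (x * b) * (y * S w).
    rewrite -[in RHS](comul_counitr b) /Fb' !(tliftE _ (comul H b)).
    rewrite mulr_sumr linear_sum mulr_suml; apply: eq_bigr => p' _.
    rewrite -scalerAr linearZ /= -scalerAl scalerAr -scalerAr.
    transitivity (S (x * p'.1) * (y * (counit H p'.2 *: 1) * S w)); last first.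
      by rewrite -!(scalerAr, scalerAl) mulr1.
    rewrite -antipoder !(tliftE _ (comul H p'.2)) mulr_sumr mulr_suml mulr_sumr.
    by apply: eq_bigr => r' _; rewrite /F !mulrA.
  rewrite -{1}(comul_counitr a) (tliftE _ (comul H a)) [RHS]tliftE mulr_suml.
  rewrite linear_sum; apply: eq_bigr => p _.
  rewrite -scalerAl linearZ /= -[in LHS](mulr1 (antipode H _)) scalerAr.
  rewrite -antipoder !(tliftE _ (comul H p.2)) mulr_sumr.
  by apply: eq_bigr => r _; rewrite eb.
transitivity (tlift (fun p w => tlift (fun x y => Fb x y w) (comul H p))
                    (comul H a)).
  rewrite [RHS]sweedler_assoc.
  - by rewrite !(tliftE _ (comul H a)); apply: eq_bigr => p _;
      apply: eq_bigr => r _; rewrite FbE.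
  - move=> y w; rewrite /Fb /tlift /tsum; apply: linear_bigsum => p'.
    apply: linear_bigsum => r' c u v.
    by rewrite /F mulrDl linearD -scalerAl linearZ /= !mulrDl -!scalerAl.
  - move=> x w; rewrite /Fb /tlift /tsum; apply: linear_bigsum => p'.
    apply: linear_bigsum => r' c u v.
    by rewrite /F !(mulrDr, mulrDl) -!(scalerAr, scalerAl).
  - move=> x y; rewrite /Fb /tlift /tsum; apply: linear_bigsum => p'.
    apply: linear_bigsum => r' c u v.
    by rewrite /F linearP !mulrDr -!scalerAr.
(* Splitting off the first two legs gives [S b * S a]. *)
have ea p w : tlift (fun x y => Fb x y w) (comul H p)
            = counit H p *: (S b * S w).
  rewrite -[in RHS](comul_counitl b) (tliftE _ (comul H b)) linear_sum mulr_suml.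
  rewrite scaler_sumr /Fb tliftE exchange_big /=; apply: eq_bigr => p' _.
  transitivity (tlift (fun x y => S x * y) (comul H (p * p'.1))
                 * (S p'.2 * S w)).
    rewrite tlift_comulM // !(tliftE _ (comul H p)) mulr_suml.
    apply: eq_bigr => r _; rewrite !(tliftE _ (comul H p'.1)) mulr_suml.
    by apply: eq_bigr.
  rewrite antipodel counitM linearZ /= -!scalerAl mul1r.
  by rewrite scalerA.
rewrite -[in RHS](comul_counitl a) !(tliftE _ (comul H a)) linear_sum mulr_sumr.
by apply: eq_bigr => p _; rewrite ea linearZ /= -scalerAr.
Qed.
End Hopf.

(** * The quantized enveloping algebra *)

Section Enveloping.
Context {R : realType} {l : nat} {A : 'M[int]_l} {d : 'I_l -> nat} {q : R}.
Local Notation C := (complex R).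
Context {U : Uq A d q}.
Local Notation K := (UK U).
Local Notation Kinv := (UKinv U).
Local Notation E := (UE U).
Local Notation F := (UF U).
Local Notation S := (antipode U).
Local Notation qi := (qi d q).

Lemma counit_Kinv i : counit U (Kinv i) = 1.
Proof.
have := counitM (h := U) (K i) (Kinv i).
by rewrite (Urel_Kinvr (Uq_rel U)) counit1 Uq_counitK mul1r.
Qed.

(** Multiplying the coproduct of [Kinv i * K i] on the right by the inverse of
    the grouplike [K i ⊗ K i] isolates the coproduct of [Kinv i]. *)
Lemma comul_Kinv i : comul U (Kinv i) = Kinv i ⊗ Kinv i.
Proof.
have hb (x y : U) : bilin (fun a b : U => (a * x) ⊗ (b * y)).
  have [h1 h2] := @tpure_bilin _ U U.
  by split=> [w c a b|a c b b']; rewrite mulrDl -scalerAl ?h1 ?h2.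
have h : comul U (Kinv i * K i) = 1 ⊗ 1.
  by rewrite (Urel_Kinvl (Uq_rel U)) comul1.
have := congr1 (tlift (fun a b : U => (a * Kinv i) ⊗ (b * Kinv i))) h.
rewrite (tlift_pure _ _ (hb _ _)) !mul1r => <-.
rewrite tlift_comulM // [LHS]tens_pureE (tliftE _ (comul U (Kinv i))).
apply: eq_bigr => p _; rewrite Uq_comulK tlift_pure.
  by rewrite -!mulrA !(Urel_Kinvr (Uq_rel U)) !mulr1.
have [h1 h2] := hb (Kinv i) (Kinv i).
by split=> [w c a b|a c b b']; rewrite mulrDr -scalerAr ?h1 ?h2.
Qed.

Lemma antipode_bilin : bilin (fun x y : U => S x * y).
Proof. exact: (mul_bilin S idfun). Qed.

Lemma antipode_K i : S (K i) = Kinv i.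
Proof.
have := antipodel (h := U) (K i).
rewrite Uq_comulK (tlift_pure _ _ antipode_bilin) Uq_counitK scale1r => e.
by rewrite -[LHS]mulr1 -(Urel_Kinvr (Uq_rel U) i) mulrA e mul1r.
Qed.

Lemma antipode_Kinv i : S (Kinv i) = K i.
Proof.
have := antipode1 (H := U).
rewrite -(Urel_Kinvr (Uq_rel U) i) antipodeM antipode_K => e.
by rewrite -[LHS]mulr1 -[in LHS](Urel_Kinvl (Uq_rel U) i) mulrA e
  (Urel_Kinvr (Uq_rel U)) mul1r.
Qed.

Lemma antipode_E i : S (E i) = - (E i * Kinv i).
Proof.
have := antipodel (h := U) (E i).
rewrite Uq_comulE tliftD; last exact: antipode_bilin.
rewrite !(tlift_pure _ _ antipode_bilin) Uq_counitE scale0r antipode1 mul1r.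
move=> /eqP; rewrite addr_eq0 => /eqP e.
by rewrite -[LHS]mulr1 -(Urel_Kinvr (Uq_rel U) i) mulrA e mulNr.
Qed.

Lemma antipode_F i : S (F i) = - (K i * F i).
Proof.
have := antipodel (h := U) (F i).
rewrite Uq_comulF tliftD; last exact: antipode_bilin.
rewrite !(tlift_pure _ _ antipode_bilin) Uq_counitF scale0r mulr1.
by rewrite antipode_Kinv => /eqP; rewrite addr_eq0 => /eqP.
Qed.

End Enveloping.

(** * Quantum coordinate algebra *)

Section CoordinateAlgebra.
Context {R : realType} {l : nat} {A : 'M[int]_l} {d : 'I_l -> nat} {q : R}.
Local Notation C := (complex R).
Context {U : Uq A d q} {O : Oq U}.
Local Notation K := (UK U).
Local Notation Kinv := (UKinv U).
Local Notation E := (UE U).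
Local Notation F := (UF U).
Local Notation qi := (qi d q).
Implicit Types (a b : O) (X Y : U).

Lemma ev_linl X : linear (fun a : O => ev a X : C^o).
Proof. by have [h _] := ev_bilin O; apply: h. Qed.

Lemma ev_linr a : linear (ev a : U -> C^o).
Proof. by have [_ h] := ev_bilin O; apply: h. Qed.

Lemma evZl c a X : ev (c *: a) X = c * ev a X.
Proof. exact: (linear_scalef (ev_linl X)). Qed.

Lemma evDl a b X : ev (a + b) X = ev a X + ev b X.
Proof. exact: (linear_addf (ev_linl X)). Qed.

Lemma ev_suml (I : Type) (s : seq I) (G : I -> O) X :
  ev (\sum_(i <- s) G i) X = \sum_(i <- s) ev (G i) X.
Proof. exact: (linear_sumf (ev_linl X)). Qed.

Lemma ev_mul_bilin a b : bilin (fun X Y : U => ev a X * ev b Y : C^o).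
Proof.
split=> [Y|X] c x y; rewrite ev_linr.
  by rewrite mulrDl -scalerAl.
by rewrite mulrDr; congr (_ + _); apply: mulrCA.
Qed.

Lemma ev_lharp X a Y : ev (lharp X a) Y = ev a (Y * X).
Proof.
rewrite ev_comul /lharp (tliftE _ (comul O a)) ev_suml.
by rewrite (tliftE _ (comul O a)); apply: eq_bigr => p _; rewrite evZl mulrC.
Qed.

Lemma lharp_linl a : linear (fun X : U => lharp X a).
Proof.
move=> c X Y; apply: ev_inj => Z.
by rewrite evDl evZl !ev_lharp mulrDr -scalerAr ev_linr.
Qed.

Lemma lharp_linr X : linear (lharp X : O -> O).
Proof.
by move=> c a b; apply: ev_inj => Z; rewrite evDl evZl !ev_lharp evDl evZl.
Qed.

Lemma lharp1 a : lharp 1 a = a.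
Proof. by apply: ev_inj => Z; rewrite ev_lharp mulr1. Qed.

Lemma lharpM X Y a : lharp (X * Y) a = lharp X (lharp Y a).
Proof. by apply: ev_inj => Z; rewrite !ev_lharp mulrA. Qed.

Lemma lharp_bilin a b : bilin (fun X Y : U => lharp X a * lharp Y b).
Proof.
split=> [Y|X] c x y; rewrite lharp_linl.
  by rewrite mulrDl -scalerAl.
by rewrite mulrDr -scalerAr.
Qed.

(** The pairing turns the coproduct of [Y * X] into the product of the
    coproducts, so products of invariants will be invariant. *)
Lemma lharp_mul X a b :
  lharp X (a * b) = tlift (fun X1 X2 => lharp X1 a * lharp X2 b) (comul U X).
Proof.
apply: ev_inj => Y; rewrite ev_lharp ev_mul.
rewrite tlift_comulM; last exact: ev_mul_bilin.
rewrite [in RHS](tliftE _ (comul U X)) ev_suml.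
rewrite (tliftE _ (comul U Y)).
under [RHS]eq_bigr => p _ do rewrite ev_mul (tliftE _ (comul U Y)).
rewrite exchange_big /=; apply: eq_bigr => p _; apply: eq_bigr => r _.
by rewrite !ev_lharp.
Qed.

Lemma lharp_KM i a b : lharp (K i) (a * b) = lharp (K i) a * lharp (K i) b.
Proof. by rewrite lharp_mul Uq_comulK (tlift_pure _ _ (lharp_bilin a b)). Qed.

Lemma lharp_EM i a b :
  lharp (E i) (a * b) = lharp (E i) a * lharp (K i) b + a * lharp (E i) b.
Proof.
rewrite lharp_mul Uq_comulE tliftD; last exact: lharp_bilin.
by rewrite !(tlift_pure _ _ (lharp_bilin a b)) lharp1.
Qed.

Lemma lharp_FM i a b :
  lharp (F i) (a * b) = lharp (F i) a * b + lharp (Kinv i) a * lharp (F i) b.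
Proof.
rewrite lharp_mul Uq_comulF tliftD; last exact: lharp_bilin.
by rewrite !(tlift_pure _ _ (lharp_bilin a b)) lharp1.
Qed.

Lemma lharp_KinvE i c a : c != 0 ->
  lharp (K i) a = c *: a -> lharp (Kinv i) a = c^-1 *: a.
Proof.
move=> c0 h; rewrite -{1}[a](scalerK c0) -h (linear_scalef (lharp_linr _)).
by rewrite -lharpM (Urel_Kinvl (Uq_rel U)) lharp1.
Qed.

Lemma Oinv_gen (G : U -> Prop) b :
  (forall X, G X -> lharp X b = counit U X *: b) -> Oinv (gen_subalg G) b.
Proof.
move=> hG X; elim=> {X} [X /hG //||c X Y _ hX _ hY|X Y _ hX _ hY].
- by rewrite lharp1 counit1 scale1r.
- by rewrite lharp_linl hX hY linearP scalerDl scalerA.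
- by rewrite lharpM hY (linear_scalef (lharp_linr _)) hX counitM scalerA mulrC.
Qed.

Lemma Oinv_lin (L : U -> Prop) c a b :
  Oinv L a -> Oinv L b -> Oinv L (c *: a + b).
Proof.
move=> ha hb X hX; rewrite lharp_linr ha // hb // scalerDr !scalerA.
by rewrite mulrC.
Qed.

Lemma flag_sP (S : {set 'I_l}) b :
  flag_s S b <-> forall j, j \in S ->
    [/\ lharp (K j) b = b, lharp (E j) b = 0 & lharp (F j) b = 0].
Proof.
split=> [h j jS | h].
  split.
  - rewrite h ?Uq_counitK ?scale1r //.
    by apply: gen_subalg_gen; exists j => //; constructor 1.
  - rewrite h ?Uq_counitE ?scale0r //.
    by apply: gen_subalg_gen; exists j => //; constructor 3.
  - rewrite h ?Uq_counitF ?scale0r //.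
    by apply: gen_subalg_gen; exists j => //; constructor 4.
apply: Oinv_gen => X [j jS [] ->]; have [hK hE hF] := h j jS.
- by rewrite hK Uq_counitK scale1r.
- rewrite (@lharp_KinvE _ 1) ?oner_neq0 ?scale1r ?invr1 ?scale1r //.
  by rewrite counit_Kinv scale1r.
- by rewrite hE Uq_counitE scale0r.
- by rewrite hF Uq_counitF scale0r.
Qed.

Variable x : 'I_l.
Local Notation P := (flag_s (O := O) [set~ x]).

(** The degree of an element of the total space is read off from the action
    of [K x]: this agrees with counting [z] positively and [zb] negatively,
    and is defined without a description of the total space by generators. *)
Definition homogeneous (k : int) (b : O) : Prop :=
  P b /\ lharp (K x) b = qi x ^ k *: b.

Lemma flag_sM a b : P a -> P b -> P (a * b).
Proof.
move=> /flag_sP ha /flag_sP hb; apply/flag_sP => j jS.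
have [aK aE aF] := ha j jS; have [bK bE bF] := hb j jS.
by rewrite lharp_KM lharp_EM lharp_FM aK aE aF bK bE bF !mulr0 !mul0r !addr0.
Qed.

Lemma flag_s1 : P 1.
Proof.
move=> X _; apply: ev_inj => Y.
by rewrite ev_lharp evZl !ev_one counitM mulrC.
Qed.

Hypothesis q0 : q != 0.

Lemma qi_neq0 i : qi i != 0.
Proof.
rewrite /Defs.qi expf_neq0 //; apply: contra q0 => /eqP e.
by case: e => ->.
Qed.

Lemma homogeneousM k m a b :
  homogeneous k a -> homogeneous m b -> homogeneous (k + m) (a * b).
Proof.
move=> [ha aK] [hb bK]; split; first exact: flag_sM.
rewrite lharp_KM aK bK -scalerAl -scalerAr scalerA expfzDr //.
exact: qi_neq0.
Qed.

Lemma homogeneous0_flag b : homogeneous 0 b -> flag (O := O) [set~ x] b.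
Proof.
move=> [/flag_sP hb bK]; rewrite expr0z scale1r in bK.
have hK i : lharp (K i) b = b.
  have [->//|ix] := eqVneq i x.
  by have [] := hb i _; rewrite // !inE.
apply: Oinv_gen => X [[i [] ->] | [j jS [] ->]].
- by rewrite hK Uq_counitK scale1r.
- rewrite (@lharp_KinvE _ 1) ?oner_neq0 ?scale1r ?invr1 ?scale1r //.
  by rewrite counit_Kinv scale1r.
- by have [_ -> _] := hb j jS; rewrite Uq_counitE scale0r.
- by have [_ _ ->] := hb j jS; rewrite Uq_counitF scale0r.
Qed.

(** [K x] normalizes the semisimple Levi part, so it acts on its invariants. *)
Lemma flag_s_lharpK b : P b -> P (lharp (K x) b).
Proof.
move=> /flag_sP hb; apply/flag_sP => j jS; have [bK bE bF] := hb j jS.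
have comm (Y : U) c : c != 0 -> K x * Y = c *: (Y * K x) -> lharp Y b = 0 ->
    lharp Y (lharp (K x) b) = 0.
  move=> c0 e h; rewrite -lharpM -[Y * _](scalerK c0) -e.
  rewrite (linear_scalef (lharp_linl b)) lharpM h.
  by rewrite (linear_zerof (lharp_linr _)) scaler0.
split.
- by rewrite -lharpM (Urel_KK (Uq_rel U)) lharpM bK.
- by apply: comm bE; [|exact: (Urel_KE (Uq_rel U))]; rewrite expfz_neq0 ?qi_neq0.
- by apply: comm bF; [|exact: (Urel_KF (Uq_rel U))]; rewrite expfz_neq0 ?qi_neq0.
Qed.

End CoordinateAlgebra.

(** * Weights *)

(** [q] is not a root of unity, its absolute value being different from 1. *)
Lemma expfz_inj (R : realType) (q : R) : [/\ q != -1, q != 0 & q != 1] ->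
  injective (fun k : int => (q%:C)%C ^ k).
Proof.
move=> [qN1 q0 q1].
have c0 : (q%:C)%C != 0 by apply: contra q0 => /eqP [->].
have nz (n : nat) : (q%:C)%C ^+ n = 1 -> n = 0%N.
  case: n => // n; rewrite -rmorphXn /= => -[] /(congr1 Num.norm).
  rewrite normrX normr1 => /eqP; rewrite pexpr_eq1 ?normr_ge0 // eqr_norml.
  by rewrite (negPf q1) (negPf qN1).
move=> k m /= e; apply/eqP; rewrite -subr_eq0; apply/eqP.
have : (q%:C)%C ^ (k - m) = 1.
  by rewrite expfzDr // -invr_expz e divff // expfz_neq0.
case: (k - m) => n; first by move=> /nz ->.
by rewrite NegzE -exprnN => /(congr1 GRing.inv); rewrite invrK invr1 => /nz.
Qed.

(** Every integer-valued function of the simple roots extends, up to a common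
    factor [N], to an integral linear functional on weights.  The symmetrized
    Cartan matrix is invertible by positivity, and its adjugate is integral;
    [N] is the square of its determinant, to make it positive. *)
Lemma cartan_solve (R : realType) (l : nat) (A : 'M[int]_l) (d : 'I_l -> nat) :
  simple_cartan R A d ->
  exists2 N : nat, (0 < N)%N & forall c : 'I_l -> int, exists n : 'I_l -> int,
    forall j, \sum_i n i * (d i)%:Z * A i j = N%:Z * c j.
Proof.
move=> hA; pose M : 'M[int]_l := \matrix_(i, j) ((d i)%:Z * A i j).
have detM : \det M != 0.
  apply/negP => /eqP h.
  pose MR : 'M[R]_l := map_mx intr M.
  have /eqP/det0P [v v0 vM] : \det MR = 0 by rewrite det_map_mx h.
  have := cartan_pos hA v0; rewrite exchange_big big1 ?ltxx //= => j _.
  have := congr1 (fun w : 'rV[R]_l => w 0 j * v 0 j) vM.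
  rewrite !mxE mul0r mulr_suml; apply: etrans; apply: eq_bigr => i _.
  by rewrite !mxE mulrAC.
exists (absz (\det M * \det M)); first by rewrite absz_gt0 mulf_neq0.
move=> c; pose w := (\det M *: (\row_j c j)) *m \adj M.
exists (fun i => w 0 i) => j.
have -> : \sum_i w 0 i * (d i)%:Z * A i j = (w *m M) 0 j.
  by rewrite mxE; apply: eq_bigr => i _; rewrite !mxE mulrA.
rewrite /w -mulmxA mul_adj_mx mul_mx_scalar !mxE mulrA.
by rewrite gez0_abs // -expr2 sqr_ge0.
Qed.

Section Modules.
Context {R : realType} {l : nat} {A : 'M[int]_l} {d : 'I_l -> nat} {q : R}.
Hypothesis hq : [/\ q != -1, q != 0 & q != 1].
Local Notation C := (complex R).
Context {U : Uq A d q}.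
Local Notation K := (UK U).
Local Notation Kinv := (UKinv U).
Local Notation E := (UE U).
Local Notation F := (UF U).
Local Notation qi := (qi d q).
Let cq : C := (q%:C)%C.
Let q0 : q != 0. Proof. by case: hq. Qed.
Let qn0 i : qi i != 0. Proof. exact: qi_neq0. Qed.

Section OneModule.
Context {V : Umod U}.
Implicit Types (X Y : U) (u w : V) (m : 'I_l -> int).
Local Notation "X ∙ u" := (mact V X u) (at level 35, right associativity).

Lemma mact1E u : 1 ∙ u = u.
Proof. by rewrite mact1 id_lfunE. Qed.

Lemma mactME X Y u : (X * Y) ∙ u = X ∙ Y ∙ u.
Proof. by rewrite mactM comp_lfunE. Qed.

Lemma mactZE c X u : (c *: X) ∙ u = c *: (X ∙ u).
Proof. by rewrite linearZ /= scale_lfunE. Qed.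

Lemma mactDE X Y u : (X + Y) ∙ u = X ∙ u + Y ∙ u.
Proof. by rewrite linearD add_lfunE. Qed.

Lemma mactNE X u : (- X) ∙ u = - (X ∙ u).
Proof. by rewrite linearN opp_lfunE. Qed.

Lemma mact_KKinv i u : K i ∙ Kinv i ∙ u = u.
Proof. by rewrite -mactME (Urel_Kinvr (Uq_rel U)) mact1E. Qed.

Lemma mact_KinvK i u : Kinv i ∙ K i ∙ u = u.
Proof. by rewrite -mactME (Urel_Kinvl (Uq_rel U)) mact1E. Qed.

Lemma mact_KE i j u : K i ∙ E j ∙ u = qi i ^ A i j *: (E j ∙ K i ∙ u).
Proof. by rewrite -!mactME (Urel_KE (Uq_rel U)) mactZE. Qed.

Lemma mact_KF i j u : K i ∙ F j ∙ u = qi i ^ (- A i j) *: (F j ∙ K i ∙ u).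
Proof. by rewrite -!mactME (Urel_KF (Uq_rel U)) mactZE. Qed.

Lemma mact_EF i j u : E i ∙ F j ∙ u = F j ∙ E i ∙ u +
  (if i == j then (qi i - (qi i)^-1)^-1 *: (K i ∙ u - Kinv i ∙ u) else 0).
Proof.
have := congr1 (fun X => X ∙ u) (Urel_EF (Uq_rel U) i j) => /=.
rewrite mactDE mactNE !mactME => /eqP; rewrite subr_eq addrC => /eqP ->.
by case: eqP => _; rewrite ?mactZE ?mactDE ?mactNE // linear0 zero_lfunE.
Qed.

Definition has_weight m u := forall i, K i ∙ u = qi i ^ m i *: u.

Lemma has_weight_Kinv m u i : has_weight m u -> Kinv i ∙ u = qi i ^ (- m i) *: u.
Proof.
move=> h; rewrite -{2}(mact_KinvK i u) h linearZ /= scalerA -expfzDr //.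
by rewrite addNr expr0z scale1r.
Qed.

Lemma has_weight_E m u j : has_weight m u ->
  has_weight (fun i => m i + A i j) (E j ∙ u).
Proof.
by move=> h i; rewrite mact_KE h linearZ /= scalerA -expfzDr // addrC.
Qed.

Lemma has_weight_F m u j : has_weight m u ->
  has_weight (fun i => m i - A i j) (F j ∙ u).
Proof.
by move=> h i; rewrite mact_KF h linearZ /= scalerA -expfzDr // addrC.
Qed.

Definition Fword (s : seq 'I_l) u : V := foldr (fun i w => F i ∙ w) u s.

Lemma has_weight_Fword m u s : has_weight m u ->
  has_weight (fun i => m i - \sum_(a <- s) A i a) (Fword s u).
Proof.
move=> h; elim: s => [|a s IH] i /=; first by rewrite big_nil subr0.
by rewrite (has_weight_F a IH) big_cons opprD addrCA addrC.
Qed.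

Definition Fspan u w : Prop :=
  exists s : seq (C * seq 'I_l), w = \sum_(p <- s) p.1 *: Fword p.2 u.

Lemma Fspan_word u s : Fspan u (Fword s u).
Proof. by exists [:: (1, s)]; rewrite big_seq1 scale1r. Qed.

Lemma Fspan_lin u c w w' : Fspan u w -> Fspan u w' -> Fspan u (c *: w + w').
Proof.
move=> [s ->] [s' ->]; exists ([seq (c * p.1, p.2) | p <- s] ++ s').
rewrite big_cat big_map scaler_sumr /=; congr (_ + _).
by apply: eq_bigr => p _; rewrite scalerA.
Qed.

Lemma Fspan0 u : Fspan u 0.
Proof. by exists [::]; rewrite big_nil. Qed.

Lemma Fspan_stable (f : {linear V -> V}) u :
  (forall s, Fspan u (f (Fword s u))) -> forall w, Fspan u w -> Fspan u (f w).
Proof.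
move=> h w [s ->]; elim: s => [|p s IH].
  by rewrite big_nil linear0; apply: Fspan0.
by rewrite big_cons linearP; apply: Fspan_lin.
Qed.

(** Commuting a raising operator through a word of lowering operators only
    produces, besides [E i ∙ u = 0], multiples of shorter words, since words
    applied to [u] are weight vectors. *)
Lemma Fspan_submod m u : has_weight m u -> (forall i, E i ∙ u = 0) ->
  forall X w, Fspan u w -> Fspan u (X ∙ w).
Proof.
move=> hu hE X.
have sF i w : Fspan u w -> Fspan u (F i ∙ w).
  by apply: Fspan_stable => s; apply: (Fspan_word u (i :: s)).
have sZ c w : Fspan u w -> Fspan u (c *: w).
  by move=> h; rewrite -[_ *: _]addr0; apply: Fspan_lin (Fspan0 u).
have sKw i s : Fspan u (K i ∙ Fword s u).
  by rewrite (has_weight_Fword s hu); apply: sZ (Fspan_word u s).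
have sKinvw i s : Fspan u (Kinv i ∙ Fword s u).
  rewrite (has_weight_Kinv _ (has_weight_Fword s hu)).
  exact: sZ (Fspan_word u s).
elim: (Uq_gen X) => {X} [X [i [] ->]||c X Y _ hX _ hY|X Y _ hX _ hY] w hw.
- apply: (Fspan_stable (f := mact V (E i))) hw => s.
  elim: s => [|a s IH] /=; first by rewrite hE; apply: Fspan0.
  rewrite mact_EF -[X in X + _]scale1r; apply: Fspan_lin; first exact: sF.
  case: eqP => _; last exact: Fspan0.
  apply: sZ; rewrite addrC -scaleN1r; apply: Fspan_lin; first exact: sKinvw.
  exact: sKw.
- exact: sF.
- by apply: (Fspan_stable (f := mact V (K i))) hw => s; exact: sKw.
- by apply: (Fspan_stable (f := mact V (Kinv i))) hw => s; exact: sKinvw.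
- by rewrite mact1E.
- by rewrite mactDE mactZE; apply: Fspan_lin; [apply: hX | apply: hY].
- by rewrite mactME; apply: hX; apply: hY.
Qed.

(** A subspace of maximal dimension among those satisfying [Q] exhausts [Q]. *)
Lemma subspace_of_pred (Q : V -> Prop) : Q 0 ->
  (forall c w w', Q w -> Q w' -> Q (c *: w + w')) ->
  exists W : {vspace V}, forall w, w \in W <-> Q w.
Proof.
move=> Q0 Qlin.
pose D k := `[< exists2 W : {vspace V}, (forall w, w \in W -> Q w) & \dim W = k >].
have D0 : exists k, D k.
  exists 0%N; apply/asboolP; exists 0%VS; last exact: dimv0.
  by move=> w; rewrite memv0 => /eqP ->.
have Dle k : D k -> (k <= \dim {:V})%N.
  by move=> /asboolP [W _ <-]; rewrite dimvS ?subvf.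
case: (ex_maxnP D0 Dle) => k /asboolP [W hW dW] kmax.
exists W => w; split=> [|Qw]; first exact: hW.
have h1 : D (\dim (W + <[w]>)%VS).
  apply/asboolP; exists (W + <[w]>)%VS => //.
  move=> _ /memv_addP [a aW [_ /vlineP [c ->] ->]].
  by rewrite addrC; apply: Qlin => //; apply: hW.
have /eqP -> : (W == W + <[w]>)%VS by rewrite eqEdim addvSl dW kmax.
by apply: (subvP (addvSr _ _)); apply: memv_line.
Qed.

Lemma irr_generated (lam : 'I_l -> nat) (v0 : V) (Q : V -> Prop) :
  is_irr_hw lam v0 ->
  Q 0 -> (forall c w w', Q w -> Q w' -> Q (c *: w + w')) ->
  (forall X w, Q w -> Q (X ∙ w)) ->
  forall w, w != 0 -> Q w -> forall u, Q u.
Proof.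
move=> irr Q0 Qlin QX w w0 Qw u.
have [W hW] := subspace_of_pred Q0 Qlin.
have [|W0|Wf] := irr_hw_irr irr (W := W).
- move=> X; apply/subvP => _ /memv_imgP [a aW ->]; apply/hW; apply: QX.
  exact/hW.
- by move/hW: Qw; rewrite W0 memv0 (negPf w0).
- by apply/hW; rewrite Wf memvf.
Qed.

End OneModule.

Section Weights.
Hypothesis hA : simple_cartan R A d.

Lemma qi_expz_inj i : injective (fun k : int => qi i ^ k).
Proof.
move=> k m; rewrite /Defs.qi !exprnP !exprz_exp => /(expfz_inj hq).
by apply: mulfI; rewrite eqz_nat -lt0n (cartan_d_pos hA).
Qed.

(** The simple roots are linearly independent: a functional that takes the same
    nonzero value on all of them computes the height. *)
Lemma sum_simple_roots (s t : seq 'I_l) :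
  (forall i, \sum_(a <- s) A i a = \sum_(a <- t) A i a) -> size s = size t.
Proof.
move=> h; have [N N0 hN] := cartan_solve hA.
have [n hn] := hN (fun=> 1).
have ht (r : seq 'I_l) :
    \sum_i n i * (d i)%:Z * (\sum_(a <- r) A i a) = N%:Z * (size r)%:Z.
  transitivity (\sum_(a <- r) \sum_i n i * (d i)%:Z * A i a).
    by rewrite exchange_big; apply: eq_bigr => i _; rewrite mulr_sumr.
  under eq_bigr => a _ do rewrite hn mulr1.
  by rewrite big_const_seq count_predT iter_addr_0 -mulr_natr natz.
have : N%:Z * (size s)%:Z = N%:Z * (size t)%:Z.
  by rewrite -!ht; apply: eq_bigr => i _; rewrite h.
move/mulfI => e; have /e [] // : N%:Z != 0 by rewrite eqz_nat -lt0n.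
Qed.

Section HighestWeight.
Context {V : Umod U}.
Local Notation "X ∙ u" := (mact V X u) (at level 35, right associativity).

Lemma hw_weight (lam : 'I_l -> nat) (v0 : V) : is_irr_hw lam v0 ->
  has_weight (fun i => (lam i)%:Z) v0.
Proof. by move=> irr i; rewrite (irr_hw_K irr) exprM. Qed.

Lemma hw_Fspan (lam : 'I_l -> nat) (v0 : V) : is_irr_hw lam v0 ->
  forall u, Fspan v0 u.
Proof.
move=> irr u; have [X ->] := irr_hw_gen irr u.
apply: (Fspan_submod (hw_weight irr) (irr_hw_E irr)).
exact: (Fspan_word v0 [::]).
Qed.

Variables (x : 'I_l) (n : nat) (v : n.+1.-tuple V) (mu : 'I_n.+1 -> 'I_l -> int).
Local Notation vN := (tnth v ord_max).
Hypothesis hV : is_irr_hw (fund_weight x) vN.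
Hypothesis hv : basis_of fullv v.
Hypothesis hmu : forall k, has_weight (mu k) (tnth v k).

Lemma coord_expand u : u = \sum_k coord v k u *: tnth v k.
Proof.
rewrite {1}(coord_basis hv (memvf u)).
by apply: eq_bigr => k _; rewrite (tnth_nth 0).
Qed.

Lemma coord_tnth k j : coord v k (tnth v j) = (j == k)%:R.
Proof. by rewrite (tnth_nth 0) coord_free // (basis_free hv). Qed.

(** [K i] acts on basis vectors with eigenvalues that determine the weight, so a
    weight vector only involves basis vectors of its own weight. *)
Lemma coord_weight m u k : has_weight m u -> coord v k u != 0 ->
  forall i, mu k i = m i.
Proof.
move=> hu fu i; apply: (@qi_expz_inj i); apply: (mulIf fu).
transitivity (coord v k (K i ∙ u)); last by rewrite hu linearZ.
rewrite {2}(coord_expand u) !linear_sum (bigD1 k) //= big1 => [|j jk].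
  by rewrite addr0 !linearZ /= hmu linearZ /= coord_tnth eqxx !mulr1 mulrC.
by rewrite !linearZ /= hmu linearZ /= coord_tnth (negPf jk) !mulr0.
Qed.

(** A nonempty word strictly lowers the height. *)
Lemma coord_max_Fword s : s != [::] -> coord v ord_max (Fword s vN) = 0.
Proof.
move=> s0; apply/eqP; apply: contraT => h.
have := coord_weight (has_weight_Fword s (hmu ord_max)) h.
move=> e; have /sum_simple_roots/size0nil/eqP : forall i,
    \sum_(a <- s) A i a = \sum_(a <- [::]) A i a.
  move=> i; rewrite big_nil; have /eqP := e i.
  by rewrite -subr_eq0 opprB addrCA subrr addr0 => /eqP.
by rewrite (negPf s0).
Qed.

Lemma hw_K_fixed j : j != x -> K j ∙ vN = vN.
Proof.
by move=> jx; rewrite (irr_hw_K hV) /fund_weight (negPf jx) muln0 scale1r.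
Qed.

Lemma hw_Kinv_fixed j : j != x -> Kinv j ∙ vN = vN.
Proof. by move=> jx; rewrite -{1}(hw_K_fixed jx) mact_KinvK. Qed.

Lemma hw_EF i j : i != x -> E i ∙ F j ∙ vN = 0.
Proof.
move=> ix; rewrite mact_EF (irr_hw_E hV) linear0 add0r; case: eqP => // _.
by rewrite hw_K_fixed // hw_Kinv_fixed // subrr scaler0.
Qed.

(** Otherwise this vector would be killed by all [E i] and, by
    [coord_max_Fword], generate a submodule that misses [vN]. *)
Lemma hw_F_killed j : j != x -> F j ∙ vN = 0.
Proof.
move=> jx; apply/eqP; apply: contraT => w0.
have hE i : E i ∙ F j ∙ vN = 0.
  have [->|ij] := eqVneq i j; first exact: hw_EF.
  by rewrite mact_EF (irr_hw_E hV) linear0 add0r (negPf ij).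
have sub := Fspan_submod (has_weight_F j (hmu ord_max)) hE.
have [s e] : Fspan (F j ∙ vN) vN.
  apply: (irr_generated hV (Q := Fspan (F j ∙ vN)) _ _ sub w0).
  - exact: Fspan0.
  - exact: Fspan_lin.
  - exact: (Fspan_word (F j ∙ vN) [::]).
have := coord_tnth ord_max ord_max; rewrite {1}e linear_sum eqxx big1 => [/eqP|p _].
  by rewrite eq_sym oner_eq0.
rewrite linearZ /=; suff -> : Fword p.2 (F j ∙ vN) = Fword (rcons p.2 j) vN.
  by rewrite coord_max_Fword ?mulr0 //; case: (p.2).
by rewrite /Fword foldr_rcons.
Qed.

Lemma coord_ext_Fword (f : {linear V -> C^o}) :
  (forall s, f (Fword s vN) = 0) -> forall u, f u = 0.
Proof.
move=> h u; have [s ->] := hw_Fspan hV u.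
by rewrite linear_sum big1 // => p _; rewrite linearZ /= h scaler0.
Qed.

Lemma coord_max_F j u : coord v ord_max (F j ∙ u) = 0.
Proof.
apply: (coord_ext_Fword (f := coord v ord_max \o mact V (F j))) => s /=.
exact: (coord_max_Fword (s := j :: s)).
Qed.

(** On a word of length [k] applied to [vN], the result has height [1 - k]
    relative to [vN]; for [k = 1] it vanishes by [hw_EF]. *)
Lemma coord_max_E j u : j != x -> coord v ord_max (E j ∙ u) = 0.
Proof.
move=> jx; apply: (coord_ext_Fword (f := coord v ord_max \o mact V (E j))) => s /=.
apply/eqP; apply: contraT => h.
have e := coord_weight (has_weight_E j (has_weight_Fword s (hmu ord_max))) h.
have /sum_simple_roots : forall i, \sum_(a <- s) A i a = \sum_(a <- [:: j]) A i a.
  move=> i; rewrite big_seq1; have /eqP := e i.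
  rewrite -subr_eq0 !opprD opprK !addrA subrr add0r subr_eq0.
  by move=> /eqP.
move: h; case: s {e} => [|a [|b s]] //=.
by rewrite hw_EF // linear0 eqxx.
Qed.

Lemma coord_max_Kinv i u :
  coord v ord_max (Kinv i ∙ u) = qi i ^ (- (i == x)%:Z) * coord v ord_max u.
Proof.
have hN := hw_weight hV.
rewrite {1}(coord_expand u) !linear_sum (bigD1 ord_max) //= big1 => [|j jk].
  by rewrite addr0 !linearZ /= (has_weight_Kinv _ hN) linearZ /= coord_tnth eqxx
     !mulr1 mulrC.
by rewrite !linearZ /= (has_weight_Kinv _ (hmu j)) linearZ /= coord_tnth
   (negPf jk) !mulr0.
Qed.

Lemma linear_ext (f g : V -> V) : linear f -> linear g ->
  (forall k, f (tnth v k) = g (tnth v k)) -> f =1 g.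
Proof.
move=> hf hg h u; rewrite (coord_expand u) (linear_sumf hf) (linear_sumf hg).
by apply: eq_bigr => k _; rewrite (linear_scalef hf) (linear_scalef hg) h.
Qed.

(** [D] acts on the vectors of weight [w] by [q] to the power [(2 rho, w)], where
    [2 rho] pairs with the simple root [j] to [2 * d j].  That power may be
    fractional, so it is taken of an [N]-th root [r] of [q]. *)
Lemma two_rho_operator : exists (D : V -> V) (c : 'I_n.+1 -> C),
  [/\ linear D,
      forall k, c k != 0 /\ D (tnth v k) = c k *: tnth v k,
      forall j u, D (E j ∙ u) = qi j ^ 2 *: (E j ∙ D u),
      forall j u, D (F j ∙ u) = qi j ^ (- 2%:Z) *: (F j ∙ D u)
    & forall j u, D (K j ∙ u) = K j ∙ D u].
Proof.
have [N N0 hN] := cartan_solve hA.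
have [m hm] := hN (fun j => 2 * (d j)%:Z).
pose r : C := N.-root cq.
have rN : r ^ N%:Z = cq by rewrite -exprnP rootCK.
have r0 : r != 0.
  apply: contra q0 => /eqP re; move: rN; rewrite re exp0rz.
  by rewrite eqz_nat eqn0Ngt N0 /= => -[->].
pose L (w : 'I_l -> int) := \sum_i m i * (d i)%:Z * w i.
have LA w j (e : int) : r ^ L (fun i => w i + e * A i j) = qi j ^ (e * 2) * r ^ L w.
  have -> : L (fun i => w i + e * A i j) = L w + N%:Z * (d j)%:Z * (e * 2).
    rewrite -mulrA [_ * (e * 2)]mulrC -[_ * 2 * _]mulrA mulrCA -hm mulr_sumr.
    by rewrite /L -big_split; apply: eq_bigr => i _; rewrite mulrDr [in RHS]mulrCA.
  rewrite expfzDr // mulrC; congr (_ * _).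
  by rewrite -!exprz_exp rN.
pose c k := r ^ L (mu k).
pose D u := \sum_k (c k * coord v k u) *: tnth v k.
have linD : linear D.
  move=> a u w; rewrite /D scaler_sumr -big_split; apply: eq_bigr => k _.
  rewrite linearP mulrDr scalerDl scalerA; congr (_ *: _ + _).
  exact: mulrCA.
have Dwt w u : has_weight w u -> D u = r ^ L w *: u.
  move=> hu; rewrite {2}(coord_expand u) scaler_sumr; apply: eq_bigr => k _.
  rewrite scalerA; have [->|fu] := eqVneq (coord v k u) 0; first by rewrite !mulr0.
  congr (_ * _ *: _); congr (_ ^ _); apply: eq_bigr => i _.
  by rewrite (coord_weight hu fu).
have linT (X : U) : linear (fun u => D (X ∙ u)).
  by move=> a u w; rewrite linearP linD.
have linT' (X : U) (a : C) : linear (fun u => a *: (X ∙ D u)).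
  by move=> b u w; rewrite linD linearP scalerDr !scalerA mulrC.
exists D, c; split=> // [k|j|j|j u].
- by split; [rewrite expfz_neq0|exact: Dwt].
- apply: linear_ext => // k; rewrite (Dwt _ _ (hmu k)).
  rewrite (Dwt (fun i => mu k i + 1 * A i j)); last first.
    by move=> i; rewrite (has_weight_E j (hmu k)) mul1r.
  by rewrite LA mul1r linearZ /= scalerA.
- apply: linear_ext => // k; rewrite (Dwt _ _ (hmu k)).
  rewrite (Dwt (fun i => mu k i + (-1) * A i j)); last first.
    by move=> i; rewrite (has_weight_F j (hmu k)) mulN1r.
  by rewrite LA mulN1r linearZ /= scalerA.
- rewrite -[RHS]scale1r; move: u; apply: linear_ext => // k.
  rewrite hmu (linear_scalef linD) (Dwt _ _ (hmu k)) scale1r [RHS]linearZ /=.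
  by rewrite hmu !scalerA mulrC.
Qed.

(** The square of the antipode acts as conjugation by [D], so [D] turns the
    relation [S(X1) X2 = counit X] into its version for the opposite
    coproduct.  By multiplicativity it holds as soon as it does on the
    generators. *)
Lemma antipode_twist (D : V -> V) : linear D ->
  (forall j u, D (E j ∙ u) = qi j ^ 2 *: (E j ∙ D u)) ->
  (forall j u, D (F j ∙ u) = qi j ^ (- 2%:Z) *: (F j ∙ D u)) ->
  (forall j u, D (K j ∙ u) = K j ∙ D u) ->
  forall X u, tlift (fun X1 X2 => antipode U X2 ∙ D (X1 ∙ u)) (comul U X)
              = counit U X *: D u.
Proof.
move=> linD DE DF DK.
have hb u : bilin (fun X1 X2 : U => antipode U X2 ∙ D (X1 ∙ u)).
  split=> [Y|Y] a X X'.
    by rewrite mactDE mactZE linD linearP.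
  by rewrite linearP mactDE mactZE.
have DKinv j u : D (Kinv j ∙ u) = Kinv j ∙ D u.
  by rewrite -{2}(mact_KKinv j u) DK mact_KinvK.
have KinvE j u : Kinv j ∙ E j ∙ u = qi j ^ (- 2%:Z) *: (E j ∙ Kinv j ∙ u).
  have := mact_KE j j (Kinv j ∙ u); rewrite mact_KKinv (cartan_diag hA) => e.
  have /(congr1 (fun w => Kinv j ∙ w)) := e; rewrite mact_KinvK linearZ /= => ->.
  by rewrite scalerA -expfzDr // addNr expr0z scale1r.
move=> X; elim: (Uq_gen X) => {X} [X [i [] ->]||c X Y _ hX _ hY|X Y _ hX _ hY] u.
- rewrite Uq_comulE (tliftD _ _ (hb u)) !(tlift_pure _ _ (hb u)) mact1E.
  rewrite antipode_K antipode_E mactNE mactME DE linearZ /= KinvE scalerA.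
  by rewrite -expfzDr // subrr expr0z scale1r subrr Uq_counitE scale0r.
- rewrite Uq_comulF (tliftD _ _ (hb u)) !(tlift_pure _ _ (hb u)).
  rewrite antipode1 mact1E antipode_F mactNE mactME DF DKinv mact_KF mact_KKinv.
  by rewrite (cartan_diag hA) subrr Uq_counitF scale0r.
- rewrite Uq_comulK (tlift_pure _ _ (hb u)) antipode_K DK mact_KinvK.
  by rewrite Uq_counitK scale1r.
- rewrite comul_Kinv (tlift_pure _ _ (hb u)) antipode_Kinv DKinv mact_KKinv.
  by rewrite counit_Kinv scale1r.
- rewrite comul1 (tlift_pure _ _ (hb u)) antipode1 !mact1E.
  by rewrite counit1 scale1r.
- rewrite linearP (tlift_linear (hb u)) hX hY linearP scalerDl scalerA.
  by [].
rewrite tlift_comulM // (tliftE _ (comul U X)) counitM -scalerA -(hY u).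
rewrite (tliftE _ (comul U Y)) scaler_sumr.
under eq_bigr => p _ do rewrite (tliftE _ (comul U Y)).
rewrite exchange_big; apply: eq_bigr => r _ /=.
rewrite -linearZ /= -hX [in RHS](tliftE _ (comul U X)) linear_sum.
by apply: eq_bigr => p _; rewrite antipodeM !mactME.
Qed.

End HighestWeight.

End Weights.

End Modules.

(** * The grading of the total space *)

(** Removing one eigenvalue with [T - lam k0] leaves a sum of fewer
    eigenvectors in [Q]. *)
Lemma eigen_components (K : fieldType) (V : lmodType K) (T : V -> V)
    (Q : V -> Prop) (I : eqType) (lam : I -> K) : linear T ->
  (forall c u w, Q u -> Q w -> Q (c *: u + w)) -> (forall u, Q u -> Q (T u)) ->
  injective lam ->
  forall (ks : seq I) (b : I -> V), uniq ks ->
  (forall k, k \in ks -> T (b k) = lam k *: b k) ->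
  Q (\sum_(k <- ks) b k) -> forall k, k \in ks -> Q (b k).
Proof.
move=> linT Qlin QT lam_inj ks; elim: ks => [|k0 ks IH] b //=.
move=> /andP[k0ks uks] hb hQ.
have QZ c u : Q u -> Q (c *: u).
  move=> Qu; have : Q (-1 *: u + u) by apply: Qlin.
  by rewrite scaleN1r addNr => Q0; rewrite -[_ *: _]addr0; apply: Qlin.
have Qks k : k \in ks -> Q (b k).
  move=> kks; have lk : lam k - lam k0 != 0.
    rewrite subr_eq0; apply: contra k0ks => /eqP/lam_inj <- //.
  rewrite -[b k](scalerK lk); apply: (QZ).
  pose b' j := (lam j - lam k0) *: b j.
  apply: (IH b') => // [j jks|].
    by rewrite /b' (linear_scalef linT) hb ?inE ?jks ?orbT // scalerA mulrC -scalerA.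
  have -> : \sum_(j <- ks) b' j =
      - lam k0 *: (\sum_(j <- k0 :: ks) b j) + T (\sum_(j <- k0 :: ks) b j).
    rewrite (linear_sumf linT) scaler_sumr -big_split big_cons /=.
    rewrite hb ?mem_head // -scalerDl addNr scale0r add0r.
    apply: eq_big_seq => j jks.
    by rewrite hb ?inE ?jks ?orbT // -scalerDl addrC.
  by apply: Qlin => //; apply: QT.
move=> k; rewrite inE => /orP [/eqP -> | /Qks //].
have -> : b k0 = -1 *: (\sum_(j <- ks) b j) + \sum_(j <- k0 :: ks) b j.
  by rewrite big_cons addrCA scaleN1r addNr addr0.
apply: (Qlin) => //.
have Q0 : Q 0 by rewrite -(scale0r (\sum_(j <- k0 :: ks) b j)); apply: QZ.
rewrite big_seq; elim/big_ind: _ => // u w Qu Qw.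
by rewrite -[u]scale1r; apply: Qlin.
Qed.

Lemma sum_by_key (V : nmodType) (I : eqType) (s : seq (I * V)) :
  \sum_(p <- s) p.2 =
  \sum_(k <- undup (map fst s)) \sum_(p <- s | p.1 == k) p.2.
Proof.
rewrite [RHS](exchange_big_dep predT) //= [LHS]big_seq [RHS]big_seq.
apply: eq_bigr => p ps.
rewrite -big_filter (perm_big [:: p.1]) ?big_seq1 //.
apply: uniq_perm => // [|k]; first by rewrite filter_uniq // undup_uniq.
rewrite mem_filter mem_undup inE eq_sym; case: eqP => // ->.
by rewrite map_f.
Qed.

Section Grading.
Context {R : realType} {l : nat} {A : 'M[int]_l} {d : 'I_l -> nat} {q : R}.
Hypothesis hq : [/\ q != -1, q != 0 & q != 1].
Hypothesis hA : simple_cartan R A d.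
Local Notation C := (complex R).
Context {U : Uq A d q} {O : Oq U}.
Local Notation K := (UK U).
Local Notation qi := (qi d q).
Let q0 : q != 0. Proof. by case: hq. Qed.

Variable x : 'I_l.
Local Notation P := (flag_s (O := O) [set~ x]).
Local Notation deg := (homogeneous (O := O) x).

(** The weight decomposition of a matrix coefficient is that of its vector, which
    is a combination of words of lowering operators on a highest weight vector. *)
Lemma irr_coef_weights (c : U -> C) : is_irr_coef c ->
  exists s : seq (int * O), (forall X, c X = \sum_(p <- s) ev p.2 X) /\
    forall p, p \in s -> lharp (K x) p.2 = qi x ^ p.1 *: p.2.
Proof.
move=> [M [lam [v0 [irr [f [w hc]]]]]].
have hw := hw_weight irr.
have [s ws] := hw_Fspan hq irr w.
have word t : exists a : O, forall X, ev a X = f (mact M X (Fword t v0)).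
  apply: Oq_coef; exists M, lam, v0; split => //.
  by exists f, (Fword t v0).
have [a ha] := choice word.
exists [seq ((lam x)%:Z - \sum_(i <- p.2) A x i, p.1 *: a p.2) | p <- s].
split=> [X|_ /mapP [p _ ->]] /=.
  rewrite hc /mcoef ws !linear_sum big_map; apply: eq_bigr => p _ /=.
  by rewrite evZl ha !linearZ.
apply: ev_inj => X; rewrite ev_lharp !evZl !ha mactME.
by rewrite (has_weight_Fword hq p.2 hw) !linearZ /= mulrCA.
Qed.

Lemma Oq_weights (a : O) : exists s : seq (int * O),
  a = \sum_(p <- s) p.2 /\
  forall p, p \in s -> lharp (K x) p.2 = qi x ^ p.1 *: p.2.
Proof.
have [m [c [hc ha]]] := Oq_span a.
have [s hs] := choice (fun k => irr_coef_weights (hc k)).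
exists (flatten [seq s k | k <- enum 'I_m]); split.
  apply: ev_inj => X; rewrite ha ev_suml big_flatten big_map big_enum /=.
  by apply: eq_bigr => k _; have [-> _] := hs k.
by move=> p /flattenP [_ /mapP [k _ ->] pk]; have [_ h] := hs k; apply: h.
Qed.

(** The [K x]-components of an invariant are invariant, the total space being
    stable under [K x]. *)
Lemma flag_s_graded b : P b -> exists s : seq O, b = \sum_(p <- s) p /\
  forall p, p \in s -> exists k, deg k p.
Proof.
move=> Pb; have [s [e hs]] := Oq_weights b.
pose ks := undup (map fst s); pose c k := \sum_(p <- s | p.1 == k) p.2.
have hc k : lharp (K x) (c k) = qi x ^ k *: c k.
  rewrite (linear_sumf (lharp_linr _)) scaler_sumr big_seq_cond [RHS]big_seq_cond.
  by apply: eq_bigr => p /andP [/hs -> /eqP ->].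
have ec : b = \sum_(k <- ks) c k by rewrite e sum_by_key.
have Pc k : k \in ks -> P (c k).
  apply: (eigen_components (T := lharp (K x)) (lam := fun k : int => qi x ^ k)).
  - exact: lharp_linr.
  - by move=> a u w; apply: Oinv_lin.
  - by move=> u; apply: flag_s_lharpK.
  - exact: (qi_expz_inj hq hA).
  - exact: undup_uniq.
  - by move=> *; apply: hc.
  - by rewrite -ec.
exists [seq c k | k <- ks]; rewrite big_map; split=> // _ /mapP [k kks ->].
by exists k; split; [exact: Pc | exact: hc].
Qed.

(** * The generators and the quantum sphere relations *)

Section Generators.
Context {V : Umod U}.
Variables (n : nat) (v : n.+1.-tuple V) (z zb : 'I_n.+1 -> O).
Hypothesis hV : is_irr_hw (fund_weight x) (tnth v ord_max).
Hypothesis hv : basis_of fullv v.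
Hypothesis hwt : forall i, is_weight_vector (tnth v i).
Hypothesis hz : forall i X, ev (z i) X = mcoef (coord v i) (tnth v ord_max) X.
Hypothesis hzb : forall j X,
  ev (zb j) X = dual_act X (coord v ord_max) (tnth v j).
Local Notation vN := (tnth v ord_max).
Local Notation S := (antipode U).
Local Notation "X ∙ u" := (mact V X u) (at level 35, right associativity).

Lemma homogeneous_z i : deg 1 (z i).
Proof.
have [mu hmu] := choice hwt.
have lz X c : X ∙ vN = c *: vN -> lharp X (z i) = c *: z i.
  move=> h; apply: ev_inj => Y; rewrite ev_lharp evZl !hz /mcoef mactME h.
  by rewrite !linearZ.
split; last first.
  by apply: lz; rewrite (hw_weight hV) /fund_weight eqxx.
apply/flag_sP => j; rewrite !inE => jx; split.
- by rewrite (lz _ 1) ?scale1r // (hw_K_fixed hV jx).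
- by rewrite (lz _ 0) ?scale0r // (irr_hw_E hV).
- by rewrite (lz _ 0) ?scale0r // (hw_F_killed hq hA hV hv hmu jx).
Qed.

Lemma homogeneous_zb j : deg (-1) (zb j).
Proof.
have [mu hmu] := choice hwt.
have lz X c : (forall u, coord v ord_max (S X ∙ u) = c * coord v ord_max u) ->
    lharp X (zb j) = c *: zb j.
  move=> h; apply: ev_inj => Y; rewrite ev_lharp evZl !hzb /dual_act.
  by rewrite antipodeM mactME h.
have hK i u : coord v ord_max (S (K i) ∙ u) =
    qi i ^ (- (i == x)%:Z) * coord v ord_max u.
  by rewrite antipode_K (coord_max_Kinv hq hV hv hmu).
split; last by apply: lz => u; rewrite hK eqxx.
apply/flag_sP => i; rewrite !inE => ix; split.
- by rewrite (lz _ 1) ?scale1r // => u; rewrite hK (negPf ix) oppr0 expr0z.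
- rewrite (lz _ 0) ?scale0r // => u; rewrite antipode_E mactNE mactME linearN.
  by rewrite /= (coord_max_E hq hA hV hv hmu) // oppr0 mul0r.
- rewrite (lz _ 0) ?scale0r // => u; rewrite antipode_F mactNE mactME linearN.
  rewrite /= mact_KF linearZ /= (coord_max_F hq hA hV hv hmu).
  by rewrite mulr0 oppr0 mul0r.
Qed.
(** Evaluated at [X] this is the matrix coefficient of [S(X1) X2] at [vN]. *)
Lemma sum_zb_z : \sum_i zb i * z i = 1.
Proof.
apply: ev_inj => X; rewrite ev_suml ev_one.
have -> : counit U X = coord v ord_max ((counit U X *: 1) ∙ vN).
  by rewrite mactZE mact1E linearZ /= coord_tnth // eqxx mulr1.
rewrite -antipodel (tliftE _ (comul U X)) linear_sum sum_lfunE linear_sum.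
under eq_bigr => i _ do rewrite ev_mul (tliftE _ (comul U X)).
rewrite exchange_big; apply: eq_bigr => p _ /=.
rewrite mactME (coord_expand hv (p.2 ∙ vN)) !linear_sum.
by apply: eq_bigr => i _; rewrite hzb hz /dual_act /mcoef !linearZ /= mulrC.
Qed.

(** Evaluated at [X] the factors appear in the order [S(X2) X1]; the weights [c],
    the eigenvalues of the two-rho operator normalized at [vN], insert that
    operator in between. *)
Lemma sum_z_zb : exists c : 'I_n.+1 -> C, \sum_i z i * (c i *: zb i) = 1.
Proof.
have [mu hmu] := choice hwt.
have [D [c [linD hD DE DF DK]]] := two_rho_operator hq hA hv hmu.
have twist := antipode_twist hq hA linD DE DF DK.
have [cN0 DN] := hD ord_max.
exists (fun i => (c ord_max)^-1 * c i).
apply: ev_inj => X; rewrite ev_suml ev_one.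
have -> : counit U X = (c ord_max)^-1 * coord v ord_max (counit U X *: D vN).
  by rewrite DN !linearZ /= coord_tnth // eqxx mulr1 mulrCA mulVf ?mulr1.
rewrite -twist (tliftE _ (comul U X)) linear_sum mulr_sumr.
under eq_bigr => i _ do rewrite ev_mul (tliftE _ (comul U X)).
rewrite exchange_big; apply: eq_bigr => p _ /=.
rewrite [in RHS](coord_expand hv (p.1 ∙ vN)) (linear_sumf linD) !linear_sum.
rewrite mulr_sumr; apply: eq_bigr => i _; have [_ Di] := hD i.
rewrite evZl hz hzb /dual_act /mcoef (linear_scalef linD) Di !linearZ /=.
by rewrite -mulrA mulrCA; congr (_ * _); rewrite mulrCA.
Qed.

End Generators.

(** * Strongness of the zero connection *)

Section ZeroConnection.
Variable G : fodc P.
Local Notation B := (flag (O := O) [set~ x]).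

Lemma flag_s0 : P 0.
Proof.
have h : P 1 by exact: flag_s1.
have := Oinv_lin (-1) h h.
by rewrite scaleN1r addNr.
Qed.

Lemma flag_s_sum (s : seq O) : (forall p, p \in s -> P p) ->
  P (\sum_(p <- s) p).
Proof.
move=> h; rewrite big_seq; apply: (big_ind P) => //; first exact: flag_s0.
by move=> a b ha hb; rewrite -[a]scale1r; apply: Oinv_lin.
Qed.

Lemma dd0 : dd G 0 = 0.
Proof.
have := dd_lin G (-1) flag_s0 flag_s0.
by rewrite scaler0 addr0 scaleN1r addNr.
Qed.

Lemma dd_sum (s : seq O) : (forall p, p \in s -> P p) ->
  dd G (\sum_(p <- s) p) = \sum_(p <- s) dd G p.
Proof.
elim: s => [|a s IH] h; first by rewrite !big_nil dd0.
have hs : forall p, p \in s -> P p by move=> p ps; apply: h; rewrite inE ps orbT.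
rewrite !big_cons -IH // -[a in LHS]scale1r dd_lin ?scale1r //.
  exact/h/mem_head.
exact: flag_s_sum.
Qed.

Lemma dd_big (I : finType) (a : I -> O) : (forall i, P (a i)) ->
  dd G (\sum_i a i) = \sum_i dd G (a i).
Proof.
move=> h; have := @dd_sum [seq a i | i <- index_enum I].
by rewrite !big_map => ->// p /mapP [i _ ->].
Qed.

Lemma restr_P_add (g g' : G) : restr_P B g -> restr_P B g' -> restr_P B (g + g').
Proof.
move=> [s hs ->] [s' hs' ->]; exists (s ++ s'); last by rewrite big_cat.
by move=> p; rewrite mem_cat => /orP [/hs|/hs'].
Qed.

Lemma restr_P_0 : restr_P B (0 : G).
Proof. by exists [::]; rewrite ?big_nil. Qed.

Lemma restr_P_ract (g : G) r : P r -> restr_P B g -> restr_P B (ract G g r).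
Proof.
move=> Pr [s hs ->]; exists [seq (p.1, p.2 * r) | p <- s].
  move=> _ /mapP [p /hs [hp Pp] ->]; split=> //=; exact: flag_sM.
rewrite big_map (linear_sumf (ract_linr Pr)) big_seq [RHS]big_seq.
by apply: eq_bigr => p /hs [_ Pp]; rewrite ractM.
Qed.

Lemma restr_P_dd_flag b : B b -> restr_P B (dd G b).
Proof.
move=> Bb; exists [:: (dd G b, 1)]; last by rewrite big_seq1 ract1.
move=> p; rewrite inE => /eqP -> /=; split; last exact: flag_s1.
exists [:: (1, b)]; last by rewrite big_seq1 lact1.
move=> r; rewrite inE => /eqP -> /=; split=> //.
by move=> X _; apply: ev_inj => Y; rewrite ev_lharp evZl !ev_one counitM mulrC.
Qed.

Lemma ract_big (I : finType) (g : G) (a : I -> O) : (forall i, P (a i)) ->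
  ract G g (\sum_i a i) = \sum_i ract G g (a i).
Proof.
have r0 : ract G g 0 = 0.
  have := ract_linl (-1) g flag_s0 flag_s0.
  by rewrite scaler0 addr0 scaleN1r addNr.
move=> h; elim: (index_enum I) => [|i s IH]; first by rewrite !big_nil.
rewrite !big_cons -IH -[a i in LHS]scale1r ract_linl ?scale1r //.
by rewrite -(big_map a predT id); apply: flag_s_sum => p /mapP [j _ ->].
Qed.

Variables (m : nat) (z zb y : 'I_m -> O).
Hypothesis hz : forall i, deg 1 (z i).
Hypothesis hzb : forall i, deg (-1) (zb i).
Hypothesis hy : forall i, deg (-1) (y i).
Hypothesis zbz : \sum_i zb i * z i = 1.
Hypothesis zy : \sum_i z i * y i = 1.
Hypothesis dz : forall i, dd G (z i) = 0.

Lemma dd_mulz p i : P p -> dd G (p * z i) = ract G (dd G p) (z i).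
Proof.
move=> Pp; have [Pz _] := hz i; rewrite dd_leibniz // dz.
by rewrite (linear_zerof (lact_linr (f:=G) Pp)) addr0.
Qed.

(** Inserting the sum of the [zb i * z i] after [p] lowers the degree of the factor
    under the differential by one, and [z i] comes out on the right. *)
Lemma dd_deg_nonneg (k : nat) p : deg k%:Z p -> restr_P B (dd G p).
Proof.
elim: k p => [|k IH] p hp; first exact/restr_P_dd_flag/homogeneous0_flag.
have hpz i : deg k%:Z (p * zb i).
  have := homogeneousM q0 hp (hzb i).
  by rewrite -addn1 PoszD addrK.
rewrite -[p]mulr1 -zbz mulr_sumr dd_big => [|i]; last first.
  by rewrite mulrA; apply: flag_sM; [case: (hpz i) | case: (hz i)].
apply: (big_ind (restr_P B)) => [||i _]; [exact: restr_P_0|exact: restr_P_add|].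
have [Ppz _] := hpz i; have [Pz _] := hz i.
by rewrite mulrA dd_mulz //; apply: restr_P_ract => //; apply: IH.
Qed.

(** Here the sum of the [z i * y i] is inserted after [dd G p], and [z i] is
    absorbed under the differential, raising the degree by one. *)
Lemma dd_deg_nonpos (k : nat) p : deg (- k%:Z) p -> restr_P B (dd G p).
Proof.
elim: k p => [|k IH] p hp; first exact/restr_P_dd_flag/homogeneous0_flag.
have hpz i : deg (- k%:Z) (p * z i).
  have := homogeneousM q0 hp (hz i).
  by rewrite -addn1 PoszD opprD subrK.
have [Pp _] := hp.
have Pzy i : P (z i * y i).
  by apply: flag_sM; [case: (hz i) | case: (hy i)].
rewrite -[dd G p](ract1 (dd G p)) -zy ract_big //.
apply: (big_ind (restr_P B)) => [||i _]; [exact: restr_P_0|exact: restr_P_add|].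
have [Py _] := hy i; have [Pz _] := hz i.
by rewrite ractM // -dd_mulz //; apply: restr_P_ract => //; apply: IH.
Qed.

Lemma restr_P_dd p : P p -> restr_P B (dd G p).
Proof.
move=> Pp; have [s [-> hs]] := flag_s_graded Pp.
rewrite dd_sum => [|a /hs [k []] //].
rewrite big_seq; apply: (big_ind (restr_P B)) => [||a /hs [k]].
- exact: restr_P_0.
- exact: restr_P_add.
by case: (intP k) => [|j|j] ha;
  [apply: (@dd_deg_nonneg 0) | apply: dd_deg_nonneg ha
  | apply: dd_deg_nonpos ha].
Qed.

End ZeroConnection.

End Grading.

(** Forms [p dp'] span the calculus, and [p] can be moved inside [Omega1(B) P]. *)
Lemma P_restr_P_total (K : fieldType) (O : algType K) (P B : O -> Prop)
    (G : fodc P) :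
  (forall p, P p -> restr_P B (dd G p)) -> forall g : G, P_restr_P B g.
Proof.
move=> h g; have [s hs ->] := dd_gen g.
rewrite big_seq; apply: (big_ind (P_restr_P B)) => [||p /hs [P1 P2]].
- by exists [::]; rewrite ?big_nil.
- move=> a b [sa ha ->] [sb hb ->]; exists (sa ++ sb); last by rewrite big_cat.
  by move=> p; rewrite mem_cat => /orP [/ha|/hb].
have [r hr ->] := h _ P2; exists [seq (p.1, u.1, u.2) | u <- r].
  by move=> _ /mapP [u /hr [hu Pu] ->].
rewrite big_map (linear_sumf (lact_linr (f:=G) P1)) big_seq [RHS]big_seq.
by apply: eq_bigr => u /hr [_ Pu]; rewrite lractA.
Qed.

Lemma tlift_eq0 (K : fieldType) (V W Z : lmodType K) (beta : V -> W -> Z) :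
  (forall v w, beta v w = 0) -> forall t, tlift beta t = 0.
Proof. by move=> h t; rewrite tliftE big1. Qed.

Theorem proposition5p8
  (R : realType) (l : nat) (A : 'M[int]_l) (d : 'I_l -> nat)
  (hA : simple_cartan R A d)
  (q : R) (hq : [/\ q != -1, q != 0 & q != 1])
  (U : Uq A d q) (O : Oq U)
  (x : 'I_l) (hx : irreducible_node A x)
  (V : Umod U) (n : nat) (v : n.+1.-tuple V)
  (hV : is_irr_hw (fund_weight x) (tnth v ord_max))
  (hv : basis_of fullv v)
  (hwt : forall i, is_weight_vector (tnth v i))
  (z zb : 'I_n.+1 -> O)
  (hz : forall i X, ev (z i) X = mcoef (coord v i) (tnth v ord_max) X)
  (hzb : forall j X,
     ev (zb j) X = dual_act X (coord v ord_max) (tnth v j))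
  (H : hopfAlgebra (complex R)) (t : int -> H) (hH : is_laurent t)
  (rho : {linear O -> tens O H})
  (hrho : forall k p, homog z zb k p -> rho p = tpure p (t k))
  (G : fodc (flag_s (O := O) [set~ x]))
  (deltaL : {linear G -> tens O G}) (hdeltaL : left_covariant deltaL)
  (hz0 : forall f, gen_subalg (fun a => exists i, a = z i) f -> dd G f = 0)
  (hrestr : restricts_to_Omega01 x G)
  (deltaR : {linear G -> tens G H}) (hdeltaR : right_covariant rho deltaR) :
  [/\ is_principal_connection (flag (O := O) [set~ x]) deltaR (fun _ : G => 0),
      is_strong (flag (O := O) [set~ x]) (fun _ : G => 0)
    & is_left_comod_map deltaL (fun _ : G => 0)].
Proof.
have lin0 : linear (fun _ : G => 0 : G) by move=> c a b; rewrite scaler0 addr0.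
have tpure0l (W : lmodType (complex R)) (w : W) : (0 : G) ⊗ w = 0.
  by have [h _] := tpure_bilin G W; exact: (linear_zerof (h w)).
have tpure0r (W : lmodType (complex R)) (w : W) : w ⊗ (0 : G) = 0.
  by have [_ h] := tpure_bilin W G; exact: (linear_zerof (h w)).
have dz i : dd G (z i) = 0 by apply: hz0; apply: gen_subalg_gen; exists i.
have [c zzb] := sum_z_zb hq hA hv hwt hz hzb.
have hzbh j := homogeneous_zb hq hA hV hv hwt hzb j.
have strong p : flag_s (O := O) [set~ x] p ->
    restr_P (flag (O := O) [set~ x]) (dd G p).
  apply: (restr_P_dd hq hA (z := z) (zb := zb) (y := fun i => c i *: zb i)) => //.
  - by move=> i; apply: (homogeneous_z hq hA hV hv hwt hz).
  - move=> i; have [Pzb Kzb] := hzbh i; split.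
      by rewrite -[_ *: _]addr0; apply: Oinv_lin => //; apply: flag_s0.
    by rewrite (linear_scalef (lharp_linr _)) Kzb !scalerA mulrC.
  - exact: (sum_zb_z hv hz hzb).
split.
- split=> // [p g Pp|g|g].
  + by rewrite (linear_zerof (lact_linr (f:=G) Pp)).
  + by rewrite linear0 /tmap tlift_eq0 // => a b; exact: tpure0l.
  + split=> // _; exact: P_restr_P_total.
- by move=> p Pp; rewrite subr0; apply: strong.
by move=> g; rewrite linear0 /tmap tlift_eq0 // => a b; exact: tpure0r.
Qed.
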